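(* Let $(X,d)$ be a compact metric space, $f_{0,\infty}=\{f_n\}_{n=0}^\infty$ a sequence of continuous self-maps of $X$, and $A\in\mathcal{S}$. Then $h_A(f_{0,\infty})>0$ if and only if $h_A(\hat{f}_{0,\infty})=+\infty$. Consequently, $h^{*}(f_{0,\infty})>0$ if and only if $h^{*}(\hat{f}_{0,\infty})=+\infty$.
   Context: $f_0^n=f_{n-1}\circ\cdots\circ f_0$, $f_0^0=\mathrm{id}$. $\mathcal S$ is the set of strictly increasing sequences $A=\{a_i\}_{i\ge1}$ of nonnegative integers. For a compact metric space $Z$ and continuous self-maps $g_{0,\infty}$ of $Z$, $h_A(g_{0,\infty})=\sup_{\mathscr A}\limsup_{n\to\infty}\frac1n\log\mathcal N(\bigvee_{i=1}^n (g_0^{a_i})^{-1}\mathscr A)$ over finite open covers $\mathscr A$ of $Z$ ($\bigvee$ = common refinement, $\mathcal N$ = minimal cardinality of a subcover), and $h^*(g_{0,\infty})=\sup_{A\in\mathcal S}h_A(g_{0,\infty})$. $\mathcal M(X)$ is the space of Borel probability measures on $X$ with the weak$^*$ topology (compact metric, e.g. via the Prohorov metric), and $\hat f_{0,\infty}=\{\hat f_n\}$ with $\hat f_n(\mu)(B)=\mu(f_n^{-1}(B))$ for Borel $B$. *)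

(* Defs.v *)
From HB Require Import structures.
From mathcomp Require Import all_boot all_order all_algebra.
From mathcomp Require Import all_classical all_reals all_analysis.
Set Implicit Arguments. Unset Strict Implicit. Unset Printing Implicit Defensive.
Import Order.TTheory GRing.Theory Num.Theory.
Import numFieldNormedType.Exports.
Local Open Scope classical_set_scope.
Local Open Scope ring_scope.

Fixpoint compn {T : Type} (g : nat -> T -> T) (k : nat) : T -> T :=
  if k is k'.+1 then g k' \o compn g k' else id.

Definition open_cover {T : Type} (op : set (set T)) (U : seq (set T)) : Prop :=
  (forall i, (i < size U)%N -> op (nth set0 U i)) /\
  (forall x, exists2 i, (i < size U)%N & nth set0 U i x).

(** The common refinement \bigvee_{i=1}^n (g_0^{a_i})^{-1} U, where the
    sequence A = {a_i}_{i>=1} is represented by [a : nat -> nat],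
    a_{i+1} = a i (so i ranges over 'I_n). *)
Definition join_cover {T : Type} (g : nat -> T -> T) (a : nat -> nat) (n : nat)
    (U : seq (set T)) : set (set T) :=
  [set B | exists c : 'I_n -> 'I_(size U),
     B = [set x | forall i : 'I_n, nth set0 U (c i) (compn g (a i) x)]].

Definition subcover_card {T : Type} (F : set (set T)) (k : nat) : Prop :=
  exists s : seq (set T), size s = k /\
    (forall i, (i < k)%N -> F (nth set0 s i)) /\
    (forall x, exists2 i, (i < k)%N & nth set0 s i x).

(** log N(F), N(F) = minimal cardinality of a subcover (+oo if none). *)
Definition logN {R : realType} {T : Type} (F : set (set T)) : \bar R :=
  ereal_inf [set (ln (k%:R : R))%:E | k in subcover_card F].

Definition seq_entropy {R : realType} {T : Type} (op : set (set T))
    (g : nat -> T -> T) (a : nat -> nat) : \bar R :=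
  ereal_sup [set limn_esup (fun n => ((n%:R : R)^-1)%:E * logN (join_cover g a n U))%E
            | U in open_cover op].

Definition strict_incr (a : nat -> nat) : Prop := forall i, (a i < a i.+1)%N.

Definition hstar {R : realType} {T : Type} (op : set (set T))
    (g : nat -> T -> T) : \bar R :=
  ereal_sup [set seq_entropy op g a | a in strict_incr].

(** pointed copy of a (nonempty) type, needed by the library's measurable
    structure on generated sigma-algebras *)
Definition ptd (T : choiceType) (x0 : T) : Type := T.
HB.instance Definition _ (T : choiceType) (x0 : T) := Choice.on (ptd x0).
HB.instance Definition _ (T : choiceType) (x0 : T) := isPointed.Build (ptd x0) x0.

Notation borel X x0 := (@g_sigma_algebraType (@ptd X x0) (@open X)).

Notation Meas X x0 R := (probability (borel X x0) R).

Definition weak_open {R : realType} (X : topologicalType) (x0 : X)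
    (W : set (Meas X x0 R)) : Prop :=
  forall mu, W mu -> exists s : seq ((X -> R) * R),
    (forall i, (i < size s)%N ->
       continuous (nth (fun=> 0, 0) s i).1 /\ 0 < (nth (fun=> 0, 0) s i).2) /\
    [set nu : Meas X x0 R | forall i, (i < size s)%N ->
       (`| \int[nu]_x ((nth (fun=> 0, 0) s i).1 x)%:E
          - \int[mu]_x ((nth (fun=> 0, 0) s i).1 x)%:E | <
        ((nth (fun=> 0, 0) s i).2)%:E)%E] `<=` W.

Lemma continuous_borel_measurable (X : topologicalType) (x0 : X) (f : X -> X) :
  continuous f -> measurable_fun [set: borel X x0] (f : borel X x0 -> borel X x0).
Proof.
move=> fc.
have := @measurability _ _ (borel X x0) (borel X x0) setT f (@open X) erefl.
apply.
move=> _ [B oB <-]; apply: sub_sigma_algebra.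
rewrite setTI; move/continuousP: fc; exact.
Qed.

Definition cont_mfun (X : topologicalType) (x0 : X) (f : X -> X)
    (hf : continuous f) : {mfun borel X x0 >-> borel X x0} :=
  HB.pack (f : borel X x0 -> borel X x0)
    (isMeasurableFun.Build _ _ _ _ _ (@continuous_borel_measurable X x0 f hf)).

Definition hatmap {R : realType} (X : topologicalType) (x0 : X) (f : X -> X)
    (hf : continuous f) (mu : Meas X x0 R) : Meas X x0 R :=
  distribution mu (cont_mfun x0 hf).

Lemma hatmapE {R : realType} (X : topologicalType) (x0 : X) (f : X -> X)
    (hf : continuous f) (mu : Meas X x0 R) (B : set X) :
  hatmap hf mu B = mu (f @^-1` B).
Proof. by []. Qed.

(* Main.v *)
(** Write M(X) for the space of probability measures.

    If h_A(f) > 0, the measures sum_j 2^j delta_{p_j} / (2^m - 1) with all p_j in an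
    (n, d)-separated set E form a family of |E|^m measures: distinct subsets of the
    weights 2^j have distinct sums, so finitely many bump functions (an annulus free
    of atoms is found by pigeonhole) separate them, uniformly in n. Hence
    h_A(fhat) >= m h_A(f) for every m.

    If h_A(f) <= 0, compactness of M(X) (the limit of measures along an ultrafilter is
    a positive functional on C(X), hence a measure by Riesz) reduces a cover of M(X)
    to finitely many functions phi_j and a tolerance. A measure mu is approximated,
    at all but a small proportion of the coordinates (i, j), by the averages of
    phi_j o f_0^{a_i} over a sample of N points with N independent of n (Maurey's
    empirical method, derandomized). The sample is recorded by N indices in a subcover
    of size e^{o(n)} and the exceptional coordinates by a sparse vector of quantized
    integrals; the number of such codes is at most e^n, so h_A(fhat) <= 1. The bound
    does not depend on A, which gives the statement on h^*. *)
Require Import Defs.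
From HB Require Import structures.
From mathcomp Require Import all_boot all_order all_algebra.
From mathcomp Require Import all_classical all_reals all_analysis measurable_realfun.
From mathcomp Require Import ring lra.
Set Implicit Arguments. Unset Strict Implicit. Unset Printing Implicit Defensive.
Import Order.TTheory GRing.Theory Num.Theory.
Import numFieldNormedType.Exports.
Local Open Scope classical_set_scope.
Local Open Scope ring_scope.

(** * Integrals of continuous functions *)

Section Integral.
Context {R : realType} {X : metricType R} {x0 : X}.
Hypothesis cX : compact [set: X].
Implicit Types (phi psi : X -> R) (mu : Meas X x0 R).

Lemma continuous_bounded phi : continuous phi ->
  exists2 M, 0 < M & forall x, `|phi x| <= M.
Proof.
move=> cphi.
have [c _ Hc] : exists2 c, c \in [set: X] &
    forall t, t \in [set: X] -> `|phi t| <= `|phi c|.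
  apply: (@compact_EVT_max X R (fun x => `|phi x|) setT) => //.
    by exists x0.
  by apply: continuous_subspaceT => x; apply: cvg_norm; exact: cphi.
exists (`|phi c| + 1) => [|x]; first by rewrite ltr_pwDr.
by rewrite (le_trans (Hc x _)) ?inE// lerDl.
Qed.

Lemma continuous_borel_real phi : continuous phi ->
  measurable_fun [set: borel X x0] (phi : borel X x0 -> R).
Proof.
move=> cphi; apply: (measurability _ (RGenOpens.measurableE R)).
move=> _ [_ [a [b ->]] <-]; apply: sub_sigma_algebra; rewrite setTI.
by move/continuousP: cphi; apply; exact: interval_open.
Qed.

Lemma continuous_integrable mu phi : continuous phi ->
  mu.-integrable [set: borel X x0] (EFin \o (phi : borel X x0 -> R)).
Proof.
move=> cphi; apply: measurable_bounded_integrable => //.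
- by rewrite [X in (X < _)%E]probability_setT ltry.
- exact: continuous_borel_real.
- have [M M0 HM] := continuous_bounded cphi.
  exists M; split; first exact: gtr0_real.
  by move=> x Mx y _; exact: le_trans (HM y) (ltW Mx).
Qed.

Definition expect mu phi : R := (\int[mu]_x (phi : borel X x0 -> R) x)%R.

Lemma expectE mu phi : continuous phi ->
  (\int[mu]_x (phi x)%:E)%E = (expect mu phi)%:E.
Proof.
by move=> cphi; rewrite /expect /Rintegral fineK//;
  exact: (integrable_fin_num measurableT (continuous_integrable mu cphi)).
Qed.

Lemma expect_cst mu (c : R) : expect mu (fun=> c) = c.
Proof. by rewrite /expect Rintegral_cst// [X in fine X]probability_setT mulr1. Qed.

Lemma expectD mu phi psi : continuous phi -> continuous psi ->
  expect mu (fun x => phi x + psi x) = expect mu phi + expect mu psi.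
Proof. by move=> ? ?; rewrite /expect RintegralD//; exact: continuous_integrable. Qed.

Lemma expectZ mu (c : R) phi : continuous phi ->
  expect mu (fun x => c * phi x) = c * expect mu phi.
Proof. by move=> ?; rewrite /expect RintegralZl//; exact: continuous_integrable. Qed.

Lemma le_expect mu phi psi : continuous phi -> continuous psi ->
  (forall x, phi x <= psi x) -> expect mu phi <= expect mu psi.
Proof.
by move=> ? ? le; apply: le_Rintegral => //; exact: continuous_integrable.
Qed.

Lemma expect_sum mu (I : Type) (r : seq I) (F : I -> X -> R) :
  (forall i, continuous (F i)) ->
  expect mu (fun x => \sum_(i <- r) F i x) = \sum_(i <- r) expect mu (F i).
Proof.
move=> cF; elim: r => [|i r IH].
  under [X in expect _ X]funext => x do rewrite big_nil.
  by rewrite big_nil expect_cst.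
under [X in expect _ X]funext => x do rewrite big_cons.
rewrite big_cons expectD// ?IH// => x.
by apply: (continuous_big (op := +%R)) => [|j _]; [exact: add_continuous|exact: cF].
Qed.

Lemma expect_hat (f : X -> X) (hf : continuous f) mu phi : continuous phi ->
  expect (hatmap hf mu) phi = expect mu (phi \o f).
Proof.
move=> cphi; rewrite /expect /Rintegral; congr fine.
apply: integral_distribution.
  by apply/measurable_EFinP; exact: continuous_borel_real.
apply: (@continuous_integrable mu (phi \o f)) => x.
by apply: continuous_comp; [exact: hf|exact: cphi].
Qed.

Lemma continuous_compn (f : nat -> X -> X) k :
  (forall n, continuous (f n)) -> continuous (compn f k).
Proof.
move=> hf; elim: k => [|k IH] x /=; first exact: cvg_id.
by apply: continuous_comp; [exact: IH|exact: hf].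
Qed.

(** Change of variables moves the orbit of [mu] into the test function. Each step peels off the
    outermost map, so the induction on [k] keeps [phi] arbitrary. *)
Lemma expect_compn_hat (f : nat -> X -> X) (hf : forall n, continuous (f n)) k mu
    phi : continuous phi ->
  expect (compn (fun n => @hatmap R X x0 (f n) (hf n)) k mu) phi =
  expect mu (phi \o compn f k).
Proof.
elim: k phi => [|k IH] phi cphi //=.
rewrite expect_hat// IH// => x.
by apply: continuous_comp; [exact: hf|exact: cphi].
Qed.

End Integral.

(** * The Riesz representation theorem on a compact metric space *)

Section DistanceToComplement.
Context {R : realType} {X : metricType R}.
Implicit Types (O : set X) (x y : X).

(* The cut-off at [1] gives a nonempty infimum also when [O] is the whole space. *)
Definition codist O x : R := inf ([set 1] `|` [set mdist x y | y in ~` O]).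

Let codist_has_inf O x : has_inf ([set 1] `|` [set mdist x y | y in ~` O]).
Proof.
split; first by exists 1; left.
by exists 0 => _ [->//|[y _ <-]]; exact: mdist_ge0.
Qed.

Lemma codist_le1 O x : codist O x <= 1.
Proof. by apply: ge_inf; [exact: (codist_has_inf O x).2|left]. Qed.

Lemma codist_le O x y : ~ O y -> codist O x <= mdist x y.
Proof. by move=> Oy; apply: ge_inf; [exact: (codist_has_inf O x).2|right; exists y]. Qed.

Lemma le_codist O x c : c <= 1 -> (forall y, ~ O y -> c <= mdist x y) ->
  c <= codist O x.
Proof.
move=> c1 cO; apply: lb_le_inf; first exact: (codist_has_inf O x).1.
by move=> _ [->//|[y Oy <-]]; exact: cO.
Qed.

Lemma codist_ge0 O x : 0 <= codist O x.
Proof. by apply: le_codist => // y _; exact: mdist_ge0. Qed.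

Lemma codist_out O x : ~ O x -> codist O x = 0.
Proof.
move=> Ox; apply/eqP; rewrite eq_le codist_ge0 andbT.
by rewrite (le_trans (codist_le x Ox))// mdistxx.
Qed.

Lemma codist_gt0 O x : open O -> O x -> 0 < codist O x.
Proof.
move=> oO Ox; have /nbhs_ballP[e /= e0 He] : nbhs x O by exact: open_nbhs_nbhs.
apply: (@lt_le_trans _ _ (Num.min 1 e)); first by rewrite lt_min ltr01.
apply: le_codist => [|y Oy]; first by rewrite ge_min lexx.
rewrite ge_min; apply/orP; right; rewrite leNgt; apply/negP => xy.
by apply: Oy; apply: He; rewrite ballEmdist.
Qed.

Lemma codist_lip O x y : codist O x <= codist O y + mdist x y.
Proof.
rewrite -lerBlDr; apply: le_codist => [|z Oz].
  by rewrite lerBlDr (le_trans (codist_le1 O x))// lerDl mdist_ge0.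
rewrite lerBlDr (le_trans (codist_le x Oz))// addrC.
exact: metric_triangle.
Qed.

Lemma lipschitz_continuous (phi : X -> R) :
  (forall x y, phi x <= phi y + mdist x y) -> continuous phi.
Proof.
move=> lip x; apply/cvgrPdist_le => e e0.
near=> y.
have xy : mdist x y <= e.
  near: y; apply/nbhs_ballP; exists e => //= y; rewrite ballEmdist; exact: ltW.
have := lip x y; have := lip y x; rewrite [mdist y x]metric_sym => h1 h2.
by rewrite ler_norml; apply/andP; split; lra.
Unshelve. all: by end_near. Qed.

Lemma codist_continuous O : continuous (codist O).
Proof. exact/lipschitz_continuous/codist_lip. Qed.

Lemma mdist_continuous x : continuous (mdist^~ x : X -> R).
Proof.
by apply: lipschitz_continuous => y z; rewrite addrC; exact: metric_triangle.
Qed.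

End DistanceToComplement.

(** * The Borel measure of a positive normalized functional *)

Section PositiveFunctional.
Context {R : realType} {X : metricType R} {x0 : X}.
Hypothesis cX : compact [set: X].
Variable L : (X -> R) -> R.
Hypothesis LD : forall phi psi : X -> R, continuous phi -> continuous psi ->
  L (fun x => phi x + psi x) = L phi + L psi.
Hypothesis LZ : forall (c : R) (phi : X -> R), continuous phi -> L (fun x => c * phi x) = c * L phi.
Hypothesis L1 : L (fun=> 1) = 1.
Hypothesis Lpos : forall phi : X -> R, continuous phi -> (forall x, 0 <= phi x) -> 0 <= L phi.
Implicit Types (phi psi : X -> R) (O W : set X).

Lemma cst_continuous_real (c : R) : continuous (fun _ : X => c).
Proof. by move=> x; exact: cvg_cst. Qed.

#[local] Hint Extern 0 (continuous _) => solve [exact: cst_continuous_real] : core.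

Lemma addr_continuous_real phi psi : continuous phi -> continuous psi ->
  continuous (fun x => phi x + psi x).
Proof. by move=> h1 h2 x; apply: cvgD; [exact: h1|exact: h2]. Qed.

Lemma mulr_continuous_real (c : R) phi : continuous phi -> continuous (fun x => c * phi x).
Proof. by move=> h1 x; apply: cvgM; [exact: cvg_cst|exact: h1]. Qed.

Lemma minr_continuous_real phi psi : continuous phi -> continuous psi ->
  continuous (fun x => Num.min (phi x) (psi x)).
Proof. by move=> h1 h2 x; apply: continuous_min; [exact: h1|exact: h2]. Qed.

Lemma maxr_continuous_real phi psi : continuous phi -> continuous psi ->
  continuous (fun x => Num.max (phi x) (psi x)).
Proof. by move=> h1 h2 x; apply: continuous_max; [exact: h1|exact: h2]. Qed.

Lemma functional_cst c : L (fun=> c) = c.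
Proof.
rewrite (_ : (fun=> c) = (fun x : X => c * 1)); first by rewrite LZ// L1 mulr1.
by apply/funext => x; rewrite mulr1.
Qed.

Lemma le_functional phi psi : continuous phi -> continuous psi ->
  (forall x, phi x <= psi x) -> L phi <= L psi.
Proof.
move=> c1 c2 le.
rewrite (_ : psi = (fun x => phi x + (psi x + (-1) * phi x))); last first.
  by apply/funext => x; rewrite mulN1r addrC subrK.
have cN := @mulr_continuous_real (-1) phi c1; rewrite LD//; last exact: addr_continuous_real.
rewrite lerDl; apply: Lpos; first exact: addr_continuous_real.
by move=> x; rewrite mulN1r subr_ge0.
Qed.

Lemma functional_sum (n : nat) (F : nat -> X -> R) : (forall i, continuous (F i)) ->
  L (fun x => \sum_(i < n) F i x) = \sum_(i < n) L (F i).
Proof.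
move=> cF; elim: n => [|n IH].
  under [X in L X]funext => x do rewrite big_ord0.
  by rewrite big_ord0 functional_cst.
under [X in L X]funext => x do rewrite big_ord_recr/=.
rewrite big_ord_recr/= LD ?IH// => x.
by apply: (continuous_big (op := +%R)) => [|j _]; [exact: add_continuous|exact: cF].
Qed.

(** Riesz's test functions for the mass of an open set, with vanishing outside [O] in place of
    compact support in [O]; small losses in height make up for the difference in the proofs
    below. *)
Definition minorant O phi := continuous phi /\
  forall x, [/\ 0 <= phi x, phi x <= 1 & ~ O x -> phi x = 0].

Definition open_mass O : R := sup [set L phi | phi in minorant O].

Lemma open_mass_has_sup O : has_sup [set L phi | phi in minorant O].
Proof.
split.
  by exists (L (fun=> 0)); exists (fun=> 0).
exists 1 => _ [phi [cphi bphi] <-]; rewrite -[leRHS]functional_cst.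
by apply: le_functional => // x; case: (bphi x).
Qed.

Lemma le_open_mass O phi : minorant O phi -> L phi <= open_mass O.
Proof. by move=> bphi; apply: ub_le_sup; [exact: (open_mass_has_sup O).2|exists phi]. Qed.

Lemma open_mass_le O c : (forall phi, minorant O phi -> L phi <= c) -> open_mass O <= c.
Proof.
move=> H; apply: ge_sup; first exact: (open_mass_has_sup O).1.
by move=> _ [phi bphi <-]; exact: H.
Qed.

Lemma open_mass_adherent O e : 0 < e -> exists2 phi, minorant O phi & open_mass O - e < L phi.
Proof.
by move=> e0; have [_ [phi b <-] lt] := sup_adherent e0 (open_mass_has_sup O); exists phi.
Qed.

Lemma open_mass_ge0 O : 0 <= open_mass O.
Proof.
by rewrite -[leLHS]functional_cst; apply: le_open_mass.
Qed.

Lemma open_massS O W : O `<=` W -> open_mass O <= open_mass W.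
Proof.
move=> OW; apply: open_mass_le => phi [cphi bphi]; apply: le_open_mass; split=> // x.
by have [h1 h2 h3] := bphi x; split=> // Wx; apply: h3 => /OW.
Qed.

Lemma open_mass0 : open_mass set0 = 0.
Proof.
apply/eqP; rewrite eq_le open_mass_ge0 andbT; apply: open_mass_le => phi [cphi bphi].
by rewrite -[leRHS]functional_cst; apply: le_functional => // x; have [_ _ ->] := bphi x.
Qed.

Lemma open_massT : open_mass setT = 1.
Proof.
apply/eqP; rewrite eq_le; apply/andP; split.
  by apply: open_mass_le => phi [cphi bphi]; rewrite -[leRHS]functional_cst;
    apply: le_functional => // x;
    case: (bphi x).
by rewrite -[leLHS]functional_cst; apply: le_open_mass; split=> // x; split=> // /(_ I).
Qed.

(** The functions [h k i] increase with [k] to the indicator of [O i], so near each point the sum of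
    [h k i] over [i < k] is at least [phi - e] for all large [k]. Compactness makes [k] uniform, and
    [L] is monotone. *)
Lemma open_mass_bigcup (O : nat -> set X) phi (e : R) : (forall i, open (O i)) ->
  minorant (\bigcup_i O i) phi -> 0 < e ->
  exists k, L phi <= \sum_(i < k) open_mass (O i) + e.
Proof.
move=> oO [cphi bphi] e0.
pose h (k i : nat) x := Num.min 1 (k%:R * codist (O i) x).
have ch k i : continuous (h k i).
  by apply: minr_continuous_real => //; apply: mulr_continuous_real; exact: codist_continuous.
have h0 k i x : 0 <= h k i x by rewrite le_min ler01 mulr_ge0// codist_ge0.
have bh k i : minorant (O i) (h k i).
  split=> // x; split => //; first by rewrite ge_min lexx.
  by move=> Ox; rewrite /h codist_out// mulr0 min_r// ler01.
pose P (k : nat) x := phi x - e <= \sum_(i < k) h k i x.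
have [k Hk] : exists k, forall x, P k x.
  have /compact_near_coveringP/(_ nat \oo P _) cov := cX.
  have [|k _ Hk] := cov.
    (* Where [phi x < e] the bound is trivial nearby; elsewhere [x] lies in some [O i], and the
       single term [h k i] already equals 1 nearby. *)
    move=> x _; have [phie|phie] := ltP (phi x) e.
      exists ([set y | phi y < e], setT) => /=.
        split; last exact: filterT.
        have : open [set y | phi y < e].
          by move/continuousP: cphi => /(_ [set t | t < e] (@open_lt R e)).
        by move=> op; apply: open_nbhs_nbhs; split.
      move=> [y k] [/= ye _]; apply: (@le_trans _ _ 0); first by rewrite subr_le0 ltW.
      exact: sumr_ge0.
    have [i _ Oix] : (\bigcup_i O i) x.
      apply: contrapT => nO; have [_ _ /(_ nO) phi0] := bphi x.
      by move: phie; rewrite phi0 leNgt e0.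
    have g0 := codist_gt0 (oO i) Oix; set g := codist (O i) x in g0 *.
    exists ([set y | g / 2 < codist (O i) y],
            [set k | (i < k)%N /\ 1 <= k%:R * (g / 2)]) => /=.
      split.
        apply: open_nbhs_nbhs; split; last by rewrite /= ltr_pdivrMr// ltr_pMr// ltr1n.
        by move/continuousP: (@codist_continuous R X (O i)) => /(_ _ (@open_gt R (g / 2))).
      exists (maxn i.+1 (Num.truncn (g / 2)^-1).+1) => //= k /=.
      rewrite geq_max => /andP[ik gk]; split=> //.
      rewrite -ler_pdivrMr ?divr_gt0// mul1r.
      apply: ltW; apply: lt_le_trans (truncnS_gt _) _.
      by rewrite ler_nat.
    move=> [y k] [/= gy [ik gk]]; rewrite /P (bigD1 (Ordinal ik))//=.
    have -> : h k i y = 1.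
      by rewrite /h min_l// (le_trans gk)// ler_wpM2l// ltW.
    apply: (@le_trans _ _ 1); last by rewrite lerDl sumr_ge0.
    by rewrite lerBlDr; have [_ + _] := bphi y; move=> /le_trans; apply; rewrite lerDl ltW.
  by exists k => x; apply: (Hk k) => //=.
exists k; rewrite -lerBlDr.
have -> : L phi - e = L (fun x => phi x + - e) by rewrite LD// functional_cst.
apply: le_trans (le_functional _ _ Hk) _.
- exact: addr_continuous_real.
- by apply: (continuous_big (op := +%R)) => [|j _]; [exact: add_continuous|exact: ch].
- by rewrite functional_sum//; apply: ler_sum => i _; exact: le_open_mass.
Qed.

Definition riesz_outer (A : set X) : \bar R :=
  ereal_inf [set (open_mass O)%:E | O in [set O | open O /\ A `<=` O]].

Lemma riesz_outer_ge0 A : (0 <= riesz_outer A)%E.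
Proof. by apply: le_ereal_inf_tmp => _ [ O _ <-]; rewrite lee_fin open_mass_ge0. Qed.

Lemma riesz_outer_open O : open O -> riesz_outer O = (open_mass O)%:E.
Proof.
move=> oO; apply/eqP; rewrite eq_le; apply/andP; split.
  by apply: ereal_inf_lbound; exists O => //; split.
by apply: le_ereal_inf_tmp => _ [W [oW OW] <-]; rewrite lee_fin; exact: open_massS.
Qed.

Lemma le_riesz_outer : {homo riesz_outer : A B / A `<=` B >-> (A <= B)%E}.
Proof.
move=> A B AB; apply: le_ereal_inf_tmp => _ [ O [oO BO] <-].
by apply: ereal_inf_lbound; exists O => //; split=> //; exact: subset_trans BO.
Qed.

Lemma riesz_outer_fin A : riesz_outer A \is a fin_num.
Proof.
rewrite ge0_fin_numE ?riesz_outer_ge0//; apply: le_lt_trans (ltry 1).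
by rewrite -open_massT -riesz_outer_open; [exact: le_riesz_outer|exact: openT].
Qed.

Lemma riesz_outer_adherent A (e : R) : 0 < e ->
  exists O, [/\ open O, A `<=` O & ((open_mass O)%:E <= riesz_outer A + e%:E)%E].
Proof.
move=> e0; have [_ [ O [oO AO] <-] lt] := lb_ereal_inf_adherent e0 (riesz_outer_fin A).
by exists O; split => //; exact: ltW.
Qed.

Lemma riesz_outer_sigma_subadditive : sigma_subadditive riesz_outer.
Proof.
move=> A; apply/lee_addgt0Pr => e e0.
have e20 : 0 < e / 2 by rewrite divr_gt0.
(* Half of [e] is shared out geometrically among the open sets [O i]; the other half pays for
   passing from their union to finitely many of them. *)
have /choice[ O HO] : forall i : nat, exists O, [/\ open O, A i `<=` O &
    ((open_mass O)%:E <= riesz_outer (A i) + (e / 2 / (2 ^ i.+1)%:R)%:E)%E].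
  by move=> i; apply: riesz_outer_adherent; rewrite divr_gt0// ltr0n expn_gt0.
have oU : open (\bigcup_i O i) by apply: bigcup_open => i _; case: (HO i).
apply: (@le_trans _ _ (riesz_outer (\bigcup_i O i))).
  by apply: le_riesz_outer => x [i _ Aix]; exists i => //; case: (HO i) => _ + _; exact.
rewrite riesz_outer_open//.
have bnd phi : minorant (\bigcup_i O i) phi ->
    ((L phi)%:E <= \sum_(0 <= i <oo) riesz_outer (A i) + e%:E)%E.
  move=> bphi; have [|k Hk] := open_mass_bigcup _ bphi e20; first by move=> i; case: (HO i).
  apply: (@le_trans _ _ (\sum_(i < k) open_mass (O i) + e / 2)%:E); first by rewrite lee_fin.
  rewrite EFinD [e in leRHS]splitr EFinD addeA leeD2r//.
  apply: (@le_trans _ _ (\sum_(i < k) (riesz_outer (A i) + (e / 2 / (2 ^ i.+1)%:R)%:E))%E).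
    by rewrite -sumEFin; apply: lee_sum => i _; case: (HO i).
  rewrite big_split/=; apply: leeD.
    rewrite -(big_mkord xpredT (fun i => riesz_outer (A i))).
    by apply: nneseries_lim_ge => *; exact: riesz_outer_ge0.
  rewrite sumEFin lee_fin.
  have : forall k, \sum_(i < k) (e / 2 / (2 ^ i.+1)%:R) = e / 2 * (1 - (2 ^ k)%:R^-1).
    elim=> [|n IH]; first by rewrite big_ord0 expn0 invr1 subrr mulr0.
    rewrite big_ord_recr/= IH expnS natrM.
    have : (2 ^ n)%:R != 0 :> R by rewrite pnatr_eq0 expn_eq0.
    by move=> ?; field.
  by move=> ->; rewrite ler_piMr ?ltW// lerBlDr lerDl invr_ge0.
have Sfin : (\sum_(0 <= i <oo) riesz_outer (A i) + e%:E)%E != -oo%E.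
  rewrite gt_eqF// (@lt_le_trans _ _ 0%E)//.
  by rewrite adde_ge0 ?lee_fin ?(ltW e0)//; apply: nneseries_ge0 => *; exact: riesz_outer_ge0.
move: bnd Sfin; case: (_ + _)%E => [s| |] // bnd _; last by rewrite leey.
by rewrite lee_fin; apply: open_mass_le => phi /bnd; rewrite lee_fin.
Qed.

#[local] HB.instance Definition _ := isOuterMeasure.Build R (ptd x0) riesz_outer
  (etrans (riesz_outer_open open0) (congr1 EFin open_mass0)) riesz_outer_ge0
  le_riesz_outer riesz_outer_sigma_subadditive.

(** For an open [W] containing [A], take [phi] nearly optimal for the part of [W] in [O], and [psi]
    nearly optimal for the set [V] of points of [W] with [phi < e / 3], which contains [A] minus
    [O]. The positive part of [phi - e / 3] and [psi] are never both positive, so their sum is a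
    minorant of [W]. *)
Lemma open_riesz_caratheodory O : open O ->
  caratheodory_measurable (riesz_outer : set (ptd x0) -> \bar R) O.
Proof.
move=> oO; apply: le_caratheodory_measurable => A.
apply: le_ereal_inf_tmp => _ [W [oW AW] <-].
apply/lee_addgt0Pr => e e0.
have e30 : 0 < e / 3 by rewrite divr_gt0.
have [phi [cphi bphi] Lphi] := open_mass_adherent (W `&` O) e30.
pose V := W `&` [set x | phi x < e / 3].
have oV : open V.
  by apply: openI => //; move/continuousP: cphi => /(_ _ (@open_lt R (e / 3))).
have [psi [cpsi bpsi] Lpsi] := open_mass_adherent V e30.
apply: (@le_trans _ _ (open_mass (W `&` O) + open_mass V)%:E).
  rewrite EFinD -!riesz_outer_open//; last exact: openI.
  apply: leeD; apply: le_riesz_outer => x [/AW Wx Ox]; split => //=.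
  by have [_ _ ->] := bphi x; [|case].
rewrite lee_fin.
have clip : continuous (fun x => Num.max (phi x + - (e / 3)) 0).
  by apply: maxr_continuous_real => //; exact: addr_continuous_real.
have : L (fun x => Num.max (phi x + - (e / 3)) 0 + psi x) <= open_mass W.
  apply: le_open_mass; split; first exact: addr_continuous_real.
  move=> x; have [p0 p1 pO] := bphi x; have [q0 q1 qV] := bpsi x.
  split.
  - by rewrite addr_ge0// le_max lexx orbT.
  - have [pe|pe] := ltP (phi x) (e / 3).
      by rewrite max_r ?add0r// subr_le0 ltW.
    rewrite qV ?addr0; last by move=> -[_ /=]; rewrite ltNge pe.
    by rewrite ge_max ler01 andbT lerBlDr (le_trans p1)// lerDl ltW.
  - move=> Wx; rewrite pO ?qV; [|by case|by case].
    by rewrite add0r addr0 max_r// oppr_le0 ltW.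
rewrite LD//.
have : L phi - e / 3 <= L (fun x => Num.max (phi x + - (e / 3)) 0).
  have -> : L phi - e / 3 = L (fun x => phi x + - (e / 3)) by rewrite LD// functional_cst.
  by apply: le_functional => //; [exact: addr_continuous_real|move=> x; rewrite le_max lexx].
lra.
Qed.


Lemma borel_riesz_caratheodory : (@measurable _ (borel X x0) : set (set X)) `<=`
  caratheodory_measurable (riesz_outer : set (ptd x0) -> \bar R).
Proof.
apply: smallest_sub; last exact: open_riesz_caratheodory.
split.
- exact: caratheodory_measurable_set0.
- move=> A mA; rewrite setTD; exact: caratheodory_measurable_setC.
- exact: caratheodory_measurable_bigcup.
Qed.

Lemma riesz_outer_sigma_additive :
  semi_sigma_additive (riesz_outer : set (borel X x0) -> \bar R).
Proof.
move=> A mA tA mU.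
apply: (@caratheodory_measure_sigma_additive R (ptd x0) riesz_outer A) => //.
- by move=> i; exact: borel_riesz_caratheodory.
- exact: borel_riesz_caratheodory.
Qed.

(** A second name for the same function: it carries the measure structure on Borel sets, while
    [riesz_outer] carries the outer measure structure. *)
Definition riesz_borel : set (borel X x0) -> \bar R := riesz_outer.

#[local] HB.instance Definition _ := isMeasure.Build _ (borel X x0) R riesz_borel
  (etrans (riesz_outer_open open0) (congr1 EFin open_mass0)) riesz_outer_ge0
  riesz_outer_sigma_additive.

#[local] HB.instance Definition _ := Measure_isProbability.Build _ (borel X x0) R riesz_borel
  (etrans (riesz_outer_open openT) (congr1 EFin open_massT)).

Definition riesz_measure : Meas X x0 R := riesz_borel.

Lemma riesz_measure_open O : open O -> riesz_measure O = (open_mass O)%:E.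
Proof. exact: riesz_outer_open. Qed.

(** Cut [phi] into [N] horizontal layers [p i] of height [1 / N]. Then [N * p i] is a minorant of
    [O i], while [p i] equals [1 / N] on [O i.+1]; this bounds [L (p i)] above and the integral of
    [p i] below by masses of consecutive level sets. *)
Lemma functional_le_expect01 phi : continuous phi -> (forall x, 0 <= phi x <= 1) ->
  L phi <= expect riesz_measure phi.
Proof.
move=> cphi bphi; apply/ler_addgt0Pr => e e0.
pose N := (Num.truncn e^-1).+1.
have N0 : 0 < N%:R :> R by rewrite ltr0n.
have Ne : N%:R^-1 <= e.
  by rewrite -[e]invrK lef_pV2 ?posrE ?invr_gt0// ltW// truncnS_gt.
pose c (i : nat) x := Num.min (phi x) (i%:R / N%:R).
have cc i : continuous (c i) by exact: minr_continuous_real.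
pose p (i : nat) x := c i.+1 x + (-1) * c i x.
have cp i : continuous (p i) by apply: addr_continuous_real => //; exact: mulr_continuous_real.
have phiE : phi = (fun x => \sum_(i < N) p i x).
  apply/funext => x; rewrite (_ : \sum_(i < N) p i x = \sum_(0 <= i < N) (c i.+1 x - c i x)).
    rewrite telescope_sumr// /c divff ?gt_eqF// mul0r.
    by have /andP[h0 h1] := bphi x; rewrite min_l// min_r// subr0.
  by rewrite big_mkord; apply: eq_bigr => i _; rewrite /p mulN1r.
pose O (i : nat) := [set x | i%:R / N%:R < phi x].
have oO i : open (O i).
  by move/continuousP: cphi => /(_ _ (@open_gt R (i%:R / N%:R))).
have step i : i.+1%:R / N%:R = i%:R / N%:R + N%:R^-1 :> R.
  by rewrite -natr1 mulrDl mul1r.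
have Lp i : L (p i) <= N%:R^-1 * open_mass (O i).
  rewrite mulrC ler_pdivlMr// mulrC -LZ//; apply: le_open_mass.
  split; first exact: mulr_continuous_real.
  move=> x; rewrite /p /c step mulN1r; split.
  - apply: mulr_ge0; first exact: ltW.
    rewrite subr_ge0 le_min ge_min lexx/= ge_min lerDl invr_ge0 ler0n.
    exact: orbT.
  - rewrite mulrC -ler_pdivlMr// mul1r.
    case: (leP (phi x) (i%:R / N%:R)) => h; rewrite lerBlDr ge_min.
      by rewrite lerDr invr_ge0 ler0n.
    by rewrite [_^-1 + _]addrC lexx orbT.
  - move=> /negP; rewrite /O/= -leNgt => h.
    by rewrite !min_l ?subrr ?mulr0// (le_trans h)// lerDl invr_ge0 ltW.
have Ep i : N%:R^-1 * open_mass (O i.+1) <= expect riesz_measure (p i).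
  have mO : measurable (O i.+1 : set (borel X x0)) by exact: sub_sigma_algebra.
  have -> : N%:R^-1 * open_mass (O i.+1) =
      \int[riesz_measure]_x (N%:R^-1 * \1_(O i.+1 : set (borel X x0)) x).
    rewrite RintegralZl//; last first.
      apply: measurable_bounded_integrable => //.
      - by rewrite [X in (X < _)%E]probability_setT ltry.
      - exists 1; split; first exact: ger0_real.
        move=> M M1 x _ /=; rewrite indicE ger0_norm//.
        by apply: le_trans (ltW M1); case: (_ \in _).
    rewrite /Rintegral integral_indic// setIT; congr (_ * _).
    exact: (congr1 fine (esym (riesz_measure_open (oO i.+1)))).
  apply: le_Rintegral => //.
  - apply: measurable_bounded_integrable => //.
    + by rewrite [X in (X < _)%E]probability_setT ltry.
    + by apply: measurable_funM => //.
    + exists 1; split; first exact: ger0_real.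
      move=> M M1 x _ /=; apply: le_trans (ltW M1).
      rewrite ger0_norm; last by rewrite mulr_ge0 ?invr_ge0 ?ler0n.
      rewrite mulr_ile1 ?invr_ge0 ?ler0n ?invf_le1 ?ler1n//.
  - exact: continuous_integrable.
  - move=> x _; rewrite indicE /p/c; case: (boolP (_ \in _)) => /= h.
    + move: h; rewrite inE/= /O/= step => h; rewrite mulr1 mulN1r.
      rewrite min_r ?(ltW h)// min_r; first by rewrite addrAC subrr add0r.
      by apply: le_trans (ltW h); rewrite lerDl invr_ge0.
    + rewrite mulr0 mulN1r subr_ge0 step le_min ge_min lexx/= ge_min lerDl.
      by rewrite invr_ge0 ler0n orbT.
rewrite phiE functional_sum// expect_sum//.
apply: (@le_trans _ _ (\sum_(i < N) N%:R^-1 * open_mass (O i))).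
  by apply: ler_sum => i _; exact: Lp.
pose A i := N%:R^-1 * open_mass (O i).
have A0 i : 0 <= A i by rewrite mulr_ge0 ?open_mass_ge0.
(* The two sums differ by a shift of the index, so only the bottom term [A 0], at most [1 / N],
   remains to be paid by [e]. *)
apply: (@le_trans _ _ (\sum_(i < N.+1) A i)).
  by rewrite [leRHS]big_ord_recr/= lerDl.
rewrite [leLHS]big_ord_recl/= addrC; apply: lerD.
  by apply: ler_sum => i _; exact: Ep.
apply: le_trans Ne; rewrite -[leRHS]mulr1 ler_wpM2l ?invr_ge0//.
by rewrite -open_massT; exact: open_massS.
Qed.

(** The affine map from [[- M, M]] onto [[0, 1]] reduces to the previous case. Since [phi] has no
    sign condition here, the inequality for [- phi] will give equality. *)
Lemma functional_le_expect phi : continuous phi -> L phi <= expect riesz_measure phi.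
Proof.
move=> cphi; have [M M0 HM] := continuous_bounded (x0 := x0) cX cphi.
have M20 : 0 < (2 * M)^-1 by rewrite invr_gt0 mulr_gt0.
have cD' : continuous (fun x => phi x + M) by exact: addr_continuous_real.
have := functional_le_expect01 (@mulr_continuous_real (2 * M)^-1 _ cD').
rewrite LZ// expectZ// LD// expectD// functional_cst expect_cst ler_pM2l// lerD2r.
apply=> x; have := HM x; rewrite ler_norml => /andP[h1 h2].
rewrite mulr_ge0 ?(ltW M20) -?lerBlDr ?sub0r//= mulrC ler_pdivrMr ?mulr_gt0//.
by lra.
Qed.

Theorem riesz_representation :
  exists mu : Meas X x0 R, forall phi, continuous phi -> expect mu phi = L phi.
Proof.
exists riesz_measure => phi cphi; apply/eqP; rewrite eq_le functional_le_expect// andbT.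
have := functional_le_expect (@mulr_continuous_real (-1) phi cphi).
by rewrite LZ// (expectZ cX)// !mulN1r lerN2.
Qed.

End PositiveFunctional.

(** * Compactness of the space of probability measures *)

Section WeakCompactness.
Context {R : realType} {X : metricType R} {x0 : X}.
Hypothesis cX : compact [set: X].
Implicit Types (s : seq (X -> R)) (e : R) (mu nu : Meas X x0 R).

(** A basic neighbourhood with one tolerance for all test functions; the minimum of the individual
    tolerances in [weak_open] brings it to this form. *)
Definition weak_ball s e mu : set (Meas X x0 R) :=
  [set nu | forall j, (j < size s)%N ->
     `|expect nu (nth (fun=> 0) s j) - expect mu (nth (fun=> 0) s j)| < e].

Definition all_continuous s :=
  forall j, (j < size s)%N -> continuous (nth (fun=> 0) s j).

Lemma weak_ball_sub s1 s2 e1 e2 mu : e1 <= e2 ->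
  (forall j, (j < size s2)%N -> exists2 i, (i < size s1)%N &
     nth (fun=> 0) s1 i = nth (fun=> 0) s2 j) ->
  weak_ball s1 e1 mu `<=` weak_ball s2 e2 mu.
Proof.
move=> e12 s12 nu H j js; have [i is1 <-] := s12 j js.
exact: lt_le_trans (H i is1) e12.
Qed.

Lemma seq_gt0_min (n : nat) (u : nat -> R) : (forall i, (i < n)%N -> 0 < u i) ->
  exists2 e, 0 < e & forall i, (i < n)%N -> e <= u i.
Proof.
elim: n => [|n IH] H; first by exists 1.
have [|e e0 He] := IH; first by move=> i i_n; apply: H; exact: ltnW.
exists (Num.min e (u n)); first by rewrite lt_min e0 H.
move=> i; rewrite ltnS leq_eqVlt => /predU1P[->|i_n]; rewrite ge_min ?lexx ?orbT//.
by rewrite He.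
Qed.

(** All integrals lie in the compact interval [[- M, M]], and the image of an ultrafilter is an
    ultrafilter, hence converges there. *)
Lemma ultra_expect_cvg (G : set_system (Meas X x0 R)) : UltraFilter G ->
  forall phi : X -> R, continuous phi -> cvg ((fun mu => expect mu phi) @ G).
Proof.
move=> GU phi cphi; have [M M0 HM] := continuous_bounded (x0 := x0) cX cphi.
have : compact `[- M, M] by exact: segment_compact.
rewrite compact_ultra => /(_ ((fun mu => expect mu phi) @ G)).
case.
- split; first exact: fmap_proper_filter.
  move=> H HF sH; rewrite predeqE => A; split; last exact: sH.
  move=> HA; have [//|GA] := in_ultra_setVsetC ((fun mu => expect mu phi) @^-1` A) GU.
  have HC : H (~` A) by exact: sH.
  have HN : H (A `&` ~` A) by exact: filterI.
  by have [? []] := filter_ex HN.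
- suff : G [set mu | expect mu phi \in `[- M, M]] by [].
  apply: (filterS _ (@filterT _ G _)) => mu _ /=.
  rewrite in_itv/=; apply/andP; split.
    rewrite -[leLHS](expect_cst mu); apply: (le_expect cX) => // x.
      exact: cvg_cst.
    by have := HM x; rewrite ler_norml => /andP[].
  rewrite -[leRHS](expect_cst mu); apply: (le_expect cX) => // x.
    exact: cvg_cst.
  by have := HM x; rewrite ler_norml => /andP[].
- by move=> p [_ /= Gp]; apply/cvg_ex; exists p.
Qed.

(* This is how compactness of the space of probability measures is used. A limit of bad centres along an ultrafilter is a positive
   functional, hence a measure, and a member of the cover around it is not bad. *)
Lemma weak_cover_lebesgue (V : seq (set (Meas X x0 R))) :
  open_cover (@weak_open R X x0) V ->
  exists s e, [/\ all_continuous s, 0 < e &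
    forall mu, exists2 i, (i < size V)%N & weak_ball s e mu `<=` nth set0 V i].
Proof.
move=> [oV cV]; apply: contrapT => nleb.
pose D : set (seq (X -> R) * R) := [set p | all_continuous p.1 /\ 0 < p.2].
(* The centres whose ball with parameters [p] fits into no member of [V]. If the claim fails, none
   of these sets is empty and they generate a proper filter. *)
pose B (p : seq (X -> R) * R) := [set mu | forall i, (i < size V)%N ->
  ~ (weak_ball p.1 p.2 mu `<=` nth set0 V i)].
have Bsub p q : (forall mu, weak_ball p.1 p.2 mu `<=` weak_ball q.1 q.2 mu) ->
    B p `<=` B q.
  by move=> pq mu Bp i iV qV; apply: (Bp i iV); exact: subset_trans qV.
have FF : Filter (filter_from D B).
  apply: filter_from_filter; first by exists ([::], 1).
  move=> [s1 e1] [s2 e2] [/= c1 p1] [/= c2 p2]; exists (s1 ++ s2, Num.min e1 e2).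
    split=> /=; last by rewrite lt_min p1.
    move=> j; rewrite size_cat nth_cat; case: ifPn => [j1 _|]; first exact: c1.
    by rewrite -leqNgt => j1 j2; apply: c2; rewrite ltn_subLR.
  rewrite subsetI; split; apply: Bsub => mu /=; apply: weak_ball_sub.
  - by rewrite ge_min lexx.
  - move=> j j1; exists j; first by rewrite size_cat ltn_addr.
    by rewrite nth_cat j1.
  - by rewrite ge_min lexx orbT.
  - move=> j j2; exists (size s1 + j)%N; first by rewrite size_cat ltn_add2l.
    by rewrite nth_cat ltnNge leq_addr/= addKn.
have PF : ProperFilter (filter_from D B).
  apply: filter_from_proper => -[s e] [/= cs e0].
  apply: contrapT => nB; apply: nleb; exists s, e; split=> // mu.
  apply: contrapT => nmu; apply: nB; exists mu => i iV sV.
  by apply: nmu; exists i.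
have [G [GU FG]] := ultraFilterLemma PF.
have GF : ProperFilter G by exact: ultra_proper.
pose L (phi : X -> R) := lim ((fun mu => expect mu phi) @ G).
have GL (phi : X -> R) : continuous phi -> (fun mu => expect mu phi) @ G --> L phi.
  by move=> ?; exact: ultra_expect_cvg.
have Luniq (phi : X -> R) l : (fun mu => expect mu phi) @ G --> l -> L phi = l.
  by move=> ?; exact: cvg_lim.
have [||||mu0 Hmu0] := @riesz_representation R X x0 cX L.
- move=> phi psi cphi cpsi; apply: Luniq.
  under eq_fun do rewrite (expectD cX)//.
  by apply: cvgD; exact: GL.
- move=> c phi cphi; apply: Luniq.
  under eq_fun do rewrite (expectZ cX)//.
  by apply: cvgMr; exact: GL.
- by apply: Luniq; under eq_fun do rewrite expect_cst; exact: cvg_cst.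
- move=> phi cphi phi0; apply: limr_ge; first exact: ultra_expect_cvg.
  apply: nearW => mu; rewrite -[leLHS](expect_cst mu); apply: (le_expect cX) => // x.
  exact: cvg_cst.
have [i iV Vi] := cV mu0; have [s [Hs sV]] := oV i iV mu0 Vi.
have [|e e0 He] := @seq_gt0_min (size s) (fun j => (nth (fun=> 0, 0) s j).2).
  by move=> j /Hs[].
have ss j : (j < size s)%N ->
    nth (fun=> 0) (map fst s) j = (nth (fun=> 0, 0) s j).1.
  by move=> js; rewrite (nth_map (fun=> 0, 0)).
have Gnear n : (n <= size s)%N -> \forall mu \near G,
    forall j, (j < n)%N -> `|expect mu (nth (fun=> 0) (map fst s) j)
       - expect mu0 (nth (fun=> 0) (map fst s) j)| < e / 2.
  elim: n => [|n IH] ns; first exact: nearW.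
  have cn : continuous (nth (fun=> 0) (map fst s) n).
    by rewrite ss//; case: (Hs n ns).
  have := GL _ cn; rewrite -Hmu0// => /cvgrPdist_lt /(_ (e / 2)) => near1.
  near=> mu => j; rewrite ltnS leq_eqVlt => /predU1P[->|jn].
    by rewrite distrC; near: mu; apply: near1; rewrite divr_gt0.
  by move: j jn; near: mu; apply: IH; exact: ltnW.
(* A bad centre [mu] within [e / 2] of [mu0]: its ball of tolerance [e / 2] lies in the
   neighbourhood of [mu0] contained in the [i]-th member of [V], a contradiction. *)
have [mu [Bmu nmu]] : exists mu, B (map fst s, e / 2) mu /\
    forall j, (j < size s)%N -> `|expect mu (nth (fun=> 0) (map fst s) j)
       - expect mu0 (nth (fun=> 0) (map fst s) j)| < e / 2.
  have GB : G (B (map fst s, e / 2)).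
    apply: FG; exists (map fst s, e / 2) => //; split=> /=; last by rewrite divr_gt0.
    by move=> j; rewrite size_map => js; rewrite ss//; case: (Hs j js).
  have [mu [h1 h2]] := filter_ex (filterI GB (Gnear _ (leqnn _))).
  by exists mu.
apply: (Bmu i iV) => nu /= Hnu; apply: sV => j js.
have [cj ej] := Hs j js.
rewrite !(expectE cX)// -EFinB/= lte_fin; apply: lt_le_trans (He j js).
have := nmu j js; have := Hnu j; rewrite size_map => /(_ js).
rewrite ss// => h1 h2; rewrite [ltRHS]splitr.
by rewrite (le_lt_trans (ler_distD (expect mu (nth (fun=> 0, 0) s j).1) _ _))// ltrD.
Unshelve. all: by end_near. Qed.

End WeakCompactness.

(** * Subcovers, separated sets and upper limits *)

Section Subcovers.
Context {R : realType} {T : Type}.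
Implicit Types (F : set (set T)) (U : seq (set T)).

(** One member of [F] per code, containing the whole fibre of that code, gives a cover. A code that
    is never taken receives the member found at [x0], so the list has length exactly [#|C|]. *)
Lemma subcover_card_code F (C : finType) (code : T -> C) (x0 : T) :
  (forall x, exists2 B, F B & forall y, code y = code x -> B y) ->
  subcover_card F #|C|.
Proof.
move=> H.
have /choice[B HB] : forall c : C, exists B, F B /\ forall y, code y = c -> B y.
  move=> c; have [[x <-]|nc] := pselect (exists x, code x = c).
    by have [B FB HB] := H x; exists B.
  have [B FB _] := H x0; exists B; split=> // y yc.
  by exfalso; apply: nc; exists y.
exists [seq B c | c <- enum C]; split; first by rewrite size_map -cardE.
have nthB (c0 : C) i : (i < #|C|)%N ->
    nth set0 [seq B c | c <- enum C] i = B (nth c0 (enum C) i).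
  by move=> iC; rewrite (nth_map c0)// -cardE.
split=> [i iC|x]; first by rewrite (nthB (code x0))//; case: (HB (nth (code x0) (enum C) i)).
exists (enum_rank (code x)); first exact: ltn_ord.
rewrite (nthB (code x0)) ?ltn_ord// nth_enum_rank.
by case: (HB (code x)) => _; apply.
Qed.

(** Pigeonhole: every point [e i] lies in a member of the subcover, and no member holds two of
    them. *)
Lemma card_le_subcover F (E : finType) (e : E -> T) k :
  (forall B, F B -> forall i j, B (e i) -> B (e j) -> i = j) ->
  subcover_card F k -> (#|E| <= k)%N.
Proof.
move=> sepE [s [sk [sF cs]]].
have /choice[h Hh] : forall i : E, exists j : 'I_k, nth set0 s j (e i).
  by move=> i; have [j jk sj] := cs (e i); exists (Ordinal jk).
rewrite -[k]card_ord; apply: (leq_card h) => i j hij.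
apply: (sepE (nth set0 s (h i))) => //; first exact: sF.
by rewrite hij.
Qed.

Lemma ln_nat_ge0 k : 0 <= ln (k%:R : R).
Proof.
by case: k => [|k]; [rewrite ln0|rewrite ln_ge0// ler1n].
Qed.

(** The convention [ln 0 = 0] covers the case [k = 0]. *)
Lemma ler_ln_nat k l : (k <= l)%N -> ln (k%:R : R) <= ln (l%:R : R).
Proof.
case: k => [|k] kl; first by rewrite [leLHS]ln0// ln_nat_ge0.
by rewrite ler_ln ?posrE ?ltr0n ?ler_nat// (leq_trans _ kl).
Qed.

Lemma logN_le F k : subcover_card F k -> (logN F <= (ln (k%:R : R))%:E)%E.
Proof. by move=> Fk; apply: ereal_inf_lbound; exists k. Qed.

Lemma logN_attained F : (exists k, subcover_card F k) ->
  exists k, [/\ subcover_card F k, forall l, subcover_card F l -> (k <= l)%N &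
    logN F = (ln (k%:R : R))%:E].
Proof.
move=> [k0 Fk0].
have ex : exists k, `[< subcover_card F k >] by exists k0; apply/asboolP.
case: (ex_minnP ex) => k /asboolP Fk mk.
have mk' l : subcover_card F l -> (k <= l)%N by move=> Fl; apply: mk; apply/asboolP.
exists k; split=> //; apply/eqP; rewrite eq_le logN_le//=.
by apply: le_ereal_inf_tmp => _ [l Fl <-]; rewrite lee_fin ler_ln_nat// mk'.
Qed.

Lemma subcover_card_join (g : nat -> T -> T) a n U (x0 : T) :
  (forall x, exists2 i, (i < size U)%N & nth set0 U i x) ->
  exists k, subcover_card (join_cover g a n U) k.
Proof.
move=> cU.
have /choice[h Hh] : forall x, exists c : {ffun 'I_n -> 'I_(size U)},
    forall i : 'I_n, nth set0 U (c i) (compn g (a i) x).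
  move=> x.
  have /choice[c Hc] : forall i : 'I_n, exists j : 'I_(size U),
      nth set0 U j (compn g (a i) x).
    by move=> i; have [j jU Uj] := cU (compn g (a i) x); exists (Ordinal jU).
  by exists (finfun c) => i; rewrite ffunE.
exists #|{: {ffun 'I_n -> 'I_(size U)}}|; apply: (subcover_card_code (code := h)) => // x.
exists [set y | forall i : 'I_n, nth set0 U (h x i) (compn g (a i) y)].
  by exists (h x).
by move=> y yx i; rewrite -yx.
Qed.

(** Points are added one at a time. If [K < k] points could not be extended, every point would be
    close to one of them, and the members of [F] around them would form a subcover of size [K]. *)
Lemma greedy_separated F (close : T -> T -> Prop) (x0 : T) k :
  (forall x y, close x y -> close y x) ->
  (forall x, exists2 B, F B & forall y, close x y -> B y) ->
  (forall l, subcover_card F l -> (k <= l)%N) ->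
  exists e : nat -> T, forall i j, (i < k)%N -> (j < k)%N -> i != j ->
    ~ close (e i) (e j).
Proof.
move=> csym cF mk.
suff H : forall K, (K <= k)%N -> exists e : nat -> T,
    forall i j, (i < j)%N -> (j < K)%N -> ~ close (e i) (e j).
  have [e He] := H k (leqnn k); exists e => i j ik jk.
  by rewrite neq_ltn => /orP[ij|ji]; [exact: He|move=> /csym; exact: He].
elim=> [|K IH] Kk; first by exists (fun=> x0).
have [e He] := IH (ltnW Kk).
have [[x Hx]|nx] := pselect (exists x, forall i, (i < K)%N -> ~ close (e i) x).
  exists (fun i => if (i == K)%N then x else e i) => i j ij.
  rewrite ltnS leq_eqVlt => /predU1P[jK|jK].
    by rewrite jK eqxx ltn_eqF -?jK//; apply: Hx; rewrite -jK.
  by rewrite !ltn_eqF// ?(ltn_trans ij)//; exact: He.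
exfalso; suff /mk : subcover_card F K by rewrite leqNgt Kk.
have /choice[B HB] : forall x, exists B, F B /\ forall y, close x y -> B y.
  by move=> x; have [B FB HB] := cF x; exists B.
exists (mkseq (B \o e) K); rewrite size_mkseq; split=> //; split.
  by move=> i iK; rewrite nth_mkseq//; case: (HB (e i)).
move=> x; apply: contrapT => H; apply: nx; exists x => i iK ix; apply: H.
by exists i => //; rewrite nth_mkseq//; case: (HB (e i)) => _; exact.
Qed.

End Subcovers.

Section Limsup.
Context {R : realType}.
Implicit Types (u v : (\bar R)^nat) (b : R).

Lemma limn_esup_lt u b : (limn_esup u < b%:E)%E -> \forall n \near \oo, (u n < b%:E)%E.
Proof.
move=> /ereal_inf_lt[_ [A [N _ NA] <-] sup_lt].
exists N => // n /NA An; apply: le_lt_trans sup_lt.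
by apply: ereal_sup_ubound; exists n.
Qed.

Lemma limn_esup_le u b : (\forall n \near \oo, (u n <= b%:E)%E) -> (limn_esup u <= b%:E)%E.
Proof.
move=> H.
apply: (@le_trans _ _ (ereal_sup (u @` [set n | (u n <= b%:E)%E]))).
  by apply: ereal_inf_lbound; exists [set n | (u n <= b%:E)%E].
by apply: ge_ereal_sup => _ [n un <-].
Qed.

End Limsup.

(** If a ball of radius [r] around [x] lies in a member, every [d < r / 2] works on the ball of
    radius [r / 2]; compactness makes [d] uniform. *)
Lemma lebesgue_number {R : realType} {X : metricType R} (U : seq (set X)) :
  compact [set: X] -> open_cover (@open X) U ->
  exists2 d : R, 0 < d & forall x, exists2 i, (i < size U)%N &
    forall y, mdist x y < d -> nth set0 U i y.
Proof.
move=> cX [oU cU].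
pose P (d : R) x := exists2 i, (i < size U)%N &
    forall y, mdist x y < d -> nth set0 U i y.
have /compact_near_coveringP/(_ R 0^'+ P _) cov := cX.
have {}cov : \forall d \near 0^'+, [set: X] `<=` P d.
  apply: cov => x _; have [i iU Ui] := cU x.
  have /nbhs_ballP[r /= r0 Hr] : nbhs x (nth set0 U i).
    by apply: open_nbhs_nbhs; split=> //; exact: oU.
  have r20 : 0 < r / 2 by rewrite divr_gt0.
  exists (ball x (r / 2), [set d | d < r / 2]) => /=.
    by split; [exact: nbhsx_ballx|exact: nbhs_right_lt].
  move=> [y d] [/= xy dr]; exists i => // z yz; apply: Hr.
  rewrite [r]splitr; apply: ball_triangle xy _; rewrite ballEmdist/=.
  exact: lt_trans dr.
have [d [d0 Hd]] := filter_ex (filterI (nbhs_right_gt (0 : R)) cov).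
by exists d => // x; exact: Hd.
Qed.

(** * A cover separating weighted m-point measures *)

(** Uniqueness of binary digits: parity gives the lowest one, and the rest follows by induction
    after halving. *)
Lemma binary_inj m (b c : 'I_m -> bool) :
  (\sum_(i < m) 2 ^ i * b i = \sum_(i < m) 2 ^ i * c i)%N -> b =1 c.
Proof.
elim: m b c => [|m IH] b c; first by move=> _ [].
rewrite !big_ord_recl !expn0 !mul1n.
under eq_bigr do rewrite lift0 expnS -mulnA.
under [in RHS]eq_bigr do rewrite lift0 expnS -mulnA.
rewrite -!big_distrr/= => H.
have bc0 : b ord0 = c ord0.
  by have := congr1 odd H; rewrite !mul2n !oddD !odd_double !addbF !oddb.
have /IH bc : (\sum_(i < m) 2 ^ i * b (lift ord0 i) = \sum_(i < m) 2 ^ i * c (lift ord0 i))%N.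
  by move: H; rewrite bc0 => /addnI /eqP; rewrite eqn_pmul2l// => /eqP.
by move=> i; case: (unliftP ord0 i) => [j ->|->//]; exact: bc.
Qed.

(** The [#|I| + 1] consecutive open intervals are disjoint, so they cannot all contain one of [#|I|]
    values. *)
Lemma empty_gap {R : realType} (I : finType) (t : I -> R) (r : nat -> R) :
  {homo r : i j / (i <= j)%N >-> i <= j} ->
  exists2 l, (l < #|I|.+1)%N & forall i, ~ (r l < t i < r l.+1).
Proof.
move=> mr; apply: contrapT => H.
have /choice[h Hh] : forall l : 'I_(#|I|.+1), exists i, r l < t i < r l.+1.
  move=> l; apply: contrapT => nl; apply: H; exists l => // i hi.
  by apply: nl; exists i.
suff : (#|'I_(#|I|.+1)| <= #|I|)%N by rewrite card_ord ltnn.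
have lt_inj (k l : 'I_(#|I|.+1)) : (k < l)%N -> h k = h l -> False.
  move=> kl hkl; have /andP[_ h1] := Hh k; have /andP[h2 _] := Hh l.
  have := lt_trans (lt_le_trans h1 (mr _ _ kl)) h2.
  by rewrite hkl ltxx.
apply: (leq_card h) => k l hkl; apply/val_inj/eqP => /=.
case: (ltngtP (k : nat) l) => //; first by move=> /lt_inj /(_ hkl).
by move=> /lt_inj /(_ (esym hkl)).
Qed.

Section Lower.
Context {R : realType} {X : metricType R} {x0 : X}.
Hypothesis cX : compact [set: X].
Implicit Types (mu nu : Meas X x0 R).

(** A convex combination of point masses, obtained from its functional by the Riesz theorem. *)
Lemma convex_dirac m (w : 'I_m -> R) (p : 'I_m -> X) :
  (forall i, 0 <= w i) -> \sum_(i < m) w i = 1 ->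
  exists mu, forall phi : X -> R, continuous phi ->
    expect mu phi = \sum_(i < m) w i * phi (p i).
Proof.
move=> w0 w1; apply: (@riesz_representation R X x0 cX
  (fun phi => \sum_(i < m) w i * phi (p i))) => //.
- by move=> phi psi _ _; rewrite -big_split/=; apply: eq_bigr => i _; rewrite mulrDr.
- by move=> c phi _; rewrite big_distrr/=; apply: eq_bigr => i _; rewrite mulrCA.
- by under eq_bigr do rewrite mulr1.
- by move=> phi _ phi0; apply: sumr_ge0 => i _; rewrite mulr_ge0.
Qed.

Lemma expect01 mu (phi : X -> R) : continuous phi -> (forall x, 0 <= phi x <= 1) ->
  0 <= expect mu phi <= 1.
Proof.
move=> cphi H; apply/andP; split.
  rewrite -[leLHS](expect_cst mu); apply: (le_expect cX) => // x.
    exact: cvg_cst.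
  by case/andP: (H x).
rewrite -[leRHS](expect_cst mu); apply: (le_expect cX) => // x.
  exact: cvg_cst.
by case/andP: (H x).
Qed.

(** The members [W c] ask each integral to be within [1 / Q] of the grid point [c j / Q]. Integrals
    lie in [[0, 1]], so [Q + 1] grid points per function suffice. *)
Lemma grid_cover (phi : nat -> X -> R) r Q : (0 < Q)%N ->
  (forall i, continuous (phi i)) -> (forall i x, 0 <= phi i x <= 1) ->
  exists V, open_cover (@weak_open R X x0) V /\
    forall i mu nu, (i < size V)%N -> nth set0 V i mu -> nth set0 V i nu ->
    forall j, (j < r)%N -> `|expect mu (phi j) - expect nu (phi j)| < 2 / Q%:R.
Proof.
move=> Q0 cphi bphi.
have Qr : 0 < Q%:R :> R by rewrite ltr0n.
pose W (c : {ffun 'I_r -> 'I_Q.+1}) : set (Meas X x0 R) :=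
  [set mu | forall j : 'I_r, `|expect mu (phi j) - (c j)%:R / Q%:R| < Q%:R^-1].
pose V := [seq W c | c <- enum {: {ffun 'I_r -> 'I_Q.+1}}].
have VW i : (i < size V)%N -> exists c, nth set0 V i = W c.
  rewrite size_map => iV; have c0 : {ffun 'I_r -> 'I_Q.+1} by exact: [ffun=> ord0].
  by exists (nth c0 (enum {: {ffun 'I_r -> 'I_Q.+1}}) i); rewrite (nth_map c0).
have WV c : exists2 i, (i < size V)%N & nth set0 V i = W c.
  exists (enum_rank c); first by rewrite size_map -cardE.
  by rewrite (nth_map c) ?nth_enum_rank// -cardE.
exists V; split; first split.
- move=> i /VW[c ->] mu Wmu.
  (* The slack left in the [j]-th strict inequality serves as tolerance; the value 1 is a filler for
     indices out of range. *)
  pose d j := if insub j is Some j' then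
    Q%:R^-1 - `|expect mu (phi j) - (c (j' : 'I_r))%:R / Q%:R| else 1.
  exists (mkseq (fun j => (phi j, d j)) r); split.
    move=> j; rewrite size_mkseq => jr; rewrite nth_mkseq//=; split; first exact: cphi.
    by rewrite /d insubT subr_gt0; exact: Wmu (Ordinal jr).
  move=> nu /= H j; have := H j; rewrite size_mkseq ltn_ord => /(_ isT).
  rewrite nth_mkseq ?ltn_ord//= !(expectE cX)// -EFinB/= lte_fin /d.
  case: insubP => [j' _ jj'|]; last by rewrite ltn_ord.
  rewrite (val_inj jj' : j' = j).
  rewrite ltrBrDr; apply: le_lt_trans.
  exact: ler_distD.
- move=> mu.
  pose t (j : nat) := Num.truncn (Q%:R * expect mu (phi j)).
  have E01 j := expect01 mu (cphi j) (bphi j).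
  have tQ j : (t j < Q.+1)%N.
    have /andP[h0 h1] := E01 j.
    rewrite ltnS /t -(ler_nat R); apply: le_trans (_ : Q%:R * expect mu (phi j) <= _).
      by rewrite truncn_le mulr_ge0.
    by rewrite ler_piMr.
  pose c : {ffun 'I_r -> 'I_Q.+1} := [ffun j => inord (t (j : 'I_r))].
  have [i iV Vi] := WV c; exists i => //; rewrite Vi => j.
  rewrite /c ffunE inordK ?tQ// -(ltr_pM2l Qr) divff ?gt_eqF//.
  rewrite -[X in X * `|_|]gtr0_norm// -normrM mulrBr mulrCA divff ?gt_eqF// mulr1.
  have /andP[h0 h1] := E01 j.
  have q0 : 0 <= Q%:R * expect mu (phi j) by rewrite mulr_ge0.
  have := truncn_itv q0; rewrite -/(t j) -natr1 => /andP[h2 h3].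
  by rewrite ger0_norm ?subr_ge0// ltrBlDl.
- move=> i mu nu /VW[c ->] Wmu Wnu j jr.
  have := Wmu (Ordinal jr); have := Wnu (Ordinal jr) => /=.
  move: (_ / _) => q h1 h2.
  apply: le_lt_trans (ler_distD q _ _) _.
  rewrite [X in _ + X]distrC -[2]/(1 + 1) mulrDl mul1r; exact: ltrD.
Qed.

(** Compactness is applied along the filter of lists generated by the sets of lists containing a
    given one. *)
Lemma finite_net (N : X -> set X) : (forall x, nbhs x (N x)) ->
  exists z : seq X, forall x, exists2 i, (i < size z)%N & N (nth x0 z i) x.
Proof.
move=> nN.
pose P (t : seq X) x := exists2 i, (i < size t)%N & N (nth x0 t i) x.
pose F := filter_from setT (fun s : seq X => [set t : seq X | {subset s <= t}]).
have FF : Filter F.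
  apply: filter_from_filter; first by exists [::].
  move=> s1 s2 _ _; exists (s1 ++ s2) => // t st; split=> x xs; apply: st;
    by rewrite mem_cat xs ?orbT.
have /compact_near_coveringP/(_ _ F P FF) cov := cX.
have [|t _ /(_ t (fun _ => id)) Ht] := cov; last by exists t => x; exact: Ht.
move=> x _; exists (N x, [set t : seq X | x \in t]) => /=.
  by split; [exact: nN|exists [:: x] => // t; apply; rewrite mem_head].
move=> [y t] [/= xy xt]; exists (index x t); first by rewrite index_mem.
by rewrite nth_index.
Qed.

(** Up to the factor [1 / W] both sums are integers, and these are distinct by uniqueness of binary
    digits. *)
Lemma weighted_sum_separation m (b c : 'I_m -> bool) (W : R) : b != c -> 0 < W ->
  W^-1 <= `|\sum_(i < m) (2 ^ i)%:R / W * (b i)%:R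
    - \sum_(i < m) (2 ^ i)%:R / W * (c i)%:R|.
Proof.
move=> bc W0.
have E (e : 'I_m -> bool) : \sum_(i < m) (2 ^ i)%:R / W * (e i)%:R =
    W^-1 * (\sum_(i < m) 2 ^ i * e i)%N%:R.
  rewrite natr_sum big_distrr/=; apply: eq_bigr => i _.
  by rewrite natrM mulrA [_ / W]mulrC.
rewrite !E -mulrBr normrM gtr0_norm ?invr_gt0// ler_peMr ?invr_ge0 ?(ltW W0)//.
set k := (\sum_(i < m) 2 ^ i * b i)%N; set l := (\sum_(i < m) 2 ^ i * c i)%N.
have kl : k != l.
  by apply: contra bc => /eqP /binary_inj bc; apply/eqP/funext.
have dist_ge1 (i j : nat) : (i < j)%N -> 1 <= `|j%:R - i%:R| :> R.
  move=> ij; rewrite ger0_norm ?subr_ge0 ?ler_nat ?(ltnW ij)//.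
  by rewrite lerBrDr addrC natr1 ler_nat.
by move: kl; rewrite neq_ltn => /orP[] /dist_ge1 //; rewrite distrC.
Qed.

(* The bumps phi fall from 1 to 0 across one of K > 2m annuli around a net point;
   on an annulus free of atoms such a bump is a 0/1 function of the atoms, and its
   two integrals are then distinct sums of the weights. *)
Lemma separating_cover m (d : R) : (0 < m)%N -> 0 < d ->
  exists V, open_cover (@weak_open R X x0) V /\
    forall i mu nu (p q : 'I_m -> X), (i < size V)%N ->
    nth set0 V i mu -> nth set0 V i nu ->
    (forall phi : X -> R, continuous phi ->
       expect mu phi = \sum_(i < m) (2 ^ i)%:R / (2 ^ m).-1%:R * phi (p i)) ->
    (forall phi : X -> R, continuous phi ->
       expect nu phi = \sum_(i < m) (2 ^ i)%:R / (2 ^ m).-1%:R * phi (q i)) ->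
    forall j, mdist (p j) (q j) < d.
Proof.
move=> m0 d0; pose K := #|{: 'I_m + 'I_m}|.+1.
pose W : R := (2 ^ m).-1%:R.
have W0 : 0 < W.
  by rewrite ltr0n -ltnS prednK ?expn_gt0//; apply: (@leq_trans (2 ^ 1)); rewrite // leq_exp2l.
have Kr : 0 < K%:R :> R by rewrite ltr0n.
pose h : R := d / 4 / K%:R.
have h0 : 0 < h by rewrite !divr_gt0.
(* The radii cut the range from [d / 4] to [d / 2] into [K] annuli. A point within [d / 4] of the
   centre is inside all of them, a point at distance at least [d] from that point is outside all of
   them. *)
pose r (l : nat) : R := d / 4 + l%:R * h.
have rK : r K = d / 2 by rewrite /r /h mulrCA divff ?gt_eqF// mulr1; lra.
have [z Hz] : exists z : seq X, forall x,
    exists2 i, (i < size z)%N & mdist x (nth x0 z i) < d / 4.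
  have [|z Hz] := @finite_net (fun y => ball y (d / 4)).
    by move=> x; apply: nbhsx_ballx; rewrite divr_gt0.
  exists z => x; have [i iz zx] := Hz x; exists i => //.
  by rewrite metric_sym; move: zx; rewrite ballEmdist.
(* The index [i] encodes the net point [i %/ K] and the annulus [i %% K], so one finite family
   serves all configurations of atoms. *)
pose phi (i : nat) (x : X) :=
  Num.max 0 (Num.min 1 ((r (i %% K).+1 + (-1) * mdist x (nth x0 z (i %/ K))) * h^-1)).
have cphi i : continuous (phi i).
  apply: maxr_continuous_real; first by move=> x; exact: cvg_cst.
  apply: minr_continuous_real; first by move=> x; exact: cvg_cst.
  move=> x; apply: cvgMl; apply: cvgD; first exact: cvg_cst.
  by apply: cvgMr; exact: mdist_continuous.
have bphi i x : 0 <= phi i x <= 1.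
  by rewrite le_max lexx/= ge_max ler01 ge_min lexx.
(* This grid size makes the tolerance [2 / Q] equal to [1 / W], the minimal gap between distinct
   weighted sums. *)
have Q0 : (0 < 2 * (2 ^ m).-1)%N by rewrite muln_gt0/= -(ltr0n R).
have [V [oV HV]] := @grid_cover phi (size z * K)%N _ Q0 cphi bphi.
exists V; split=> // i mu nu p q iV Vmu Vnu Emu Enu j.
rewrite ltNge; apply/negP => dpq.
have [s sz ps] := Hz (p j).
set y := nth x0 z s in ps.
pose t (k : 'I_m + 'I_m) := match k with inl k => mdist (p k) y | inr k => mdist (q k) y end.
have rmono : {homo r : i j / (i <= j)%N >-> i <= j}.
  by move=> a b ab; rewrite lerD2l ler_wpM2r ?ler_nat// ltW.
have [l lK Hl] := empty_gap t rmono.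
pose u := (s * K + l)%N.
have uK : (u < size z * K)%N.
  apply: (@leq_trans (s.+1 * K)); last by rewrite leq_mul2r sz orbT.
  by rewrite /u mulSn [ltnRHS]addnC ltn_add2l.
have phiE x : ~ (r l < mdist x y < r l.+1) -> phi u x = (mdist x y <= r l)%R%:R.
  rewrite /phi /u modnMDl modn_small// divnMDl// divn_small// addn0 -/y => nx.
  have rl : r l.+1 = r l + h by rewrite /r -natr1; lra.
  case: (leP (mdist x y) (r l)) => xl /=.
    by rewrite min_l ?max_r// ler_pdivlMr// mul1r rl; move: xl; clear; lra.
  have {}nx : r l.+1 <= mdist x y by rewrite leNgt; apply/negP => ?; apply: nx; apply/andP.
  have nonpos : (r l.+1 + -1 * mdist x y) * h^-1 <= 0.
    by rewrite pmulr_lle0 ?invr_gt0//; lra.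
  by rewrite min_r ?max_l// (le_trans nonpos).
have := HV i mu nu iV Vmu Vnu u uK.
rewrite Emu// Enu//.
under eq_bigr => k _ do rewrite (phiE _ (Hl (inl k))).
under [X in _ - X]eq_bigr => k _ do rewrite (phiE _ (Hl (inr k))).
have bneq : (fun k => mdist (p k) y <= r l) != (fun k => mdist (q k) y <= r l).
  apply/eqP => /(congr1 (fun f => f j)) /=.
  have -> : mdist (p j) y <= r l.
    by rewrite (le_trans (ltW ps))// lerDl mulr_ge0// ltW.
  move=> /esym ql; have rl2 : r l <= d / 2 by rewrite -rK rmono// ltnW.
  have := metric_triangle (p j) y (q j); rewrite [mdist y _]metric_sym.
  by move: d0 ps ql rl2 dpq; clear; lra.
have := weighted_sum_separation bneq W0.
rewrite natrM -/W => h1 h2; have := le_lt_trans h1 h2.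
have -> : 2 / (2 * W) = W^-1 by field; rewrite gt_eqF.
by rewrite ltxx.
Qed.

End Lower.

(** * The lower bound *)

Section EntropyLower.
Context {R : realType} {X : metricType R} {x0 : X}.
Hypothesis cX : compact [set: X].
Variable f : nat -> X -> X.
Hypothesis hf : forall n, continuous (f n).
Let fhat n := @hatmap R X x0 (f n) (@hf n).

(** With [V] fixed before [a] and [n], take [k] separated points and one measure for each of the
    [k ^ m] maps from ['I_m] to ['I_k]. Two measures in one member of the join would have
    corresponding atoms close along the whole orbit, hence equal. *)
Lemma logN_join_power m U : (0 < m)%N -> open_cover (@open X) U ->
  exists V, open_cover (@weak_open R X x0) V /\ forall a n, exists k,
    logN (join_cover f a n U) = (ln (k%:R : R))%:E /\
    ((m%:R * ln (k%:R : R))%:E <= logN (join_cover fhat a n V))%E.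
Proof.
move=> m0 oU; have [d d0 Hd] := lebesgue_number cX oU.
have [V [oV HV]] := separating_cover (x0 := x0) cX m0 d0.
exists V; split=> // a n.
have [k [Fk mk ->]] := @logN_attained R _ _ (subcover_card_join f a n x0 oU.2).
exists k; split=> //.
(* As [d] is a Lebesgue number of [U], the points close to a given one lie in a single member of the
   join. *)
pose close x y := forall i : 'I_n, mdist (compn f (a i) x) (compn f (a i) y) < d.
have [||e He] := @greedy_separated X (join_cover f a n U) close x0 k _ _ mk.
- by move=> x y xy i; rewrite metric_sym.
- move=> x; have /choice[c Hc] : forall i : 'I_n, exists j : 'I_(size U),
      forall y, mdist (compn f (a i) x) y < d -> nth set0 U j y.
    by move=> i; have [j jU Hj] := Hd (compn f (a i) x); exists (Ordinal jU).
  exists [set y | forall i : 'I_n, nth set0 U (c i) (compn f (a i) y)].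
    by exists c.
  by move=> y xy i; exact: Hc.
pose w (i : 'I_m) : R := (2 ^ i)%:R / (2 ^ m).-1%:R.
have w0 i : 0 <= w i by rewrite divr_ge0.
have w1 : \sum_(i < m) w i = 1.
  rewrite -mulr_suml -natr_sum predn_exp mul1n divff// pnatr_eq0 -lt0n.
  by rewrite (bigD1 (Ordinal m0))//= expn0.
have /choice[M HM] : forall g : {ffun 'I_m -> 'I_k}, exists mu : Meas X x0 R,
    forall phi : X -> R, continuous phi -> expect mu phi = \sum_(i < m) w i * phi (e (g i)).
  by move=> g; exact: (convex_dirac cX (fun i => e (g i)) w0 w1).
have kl l : subcover_card (join_cover fhat a n V) l -> (k ^ m <= l)%N.
  move=> Fl; have := @card_le_subcover _ _ _ M l _ Fl.
  rewrite card_ffun !card_ord; apply => _ [c ->] g h /= Mg Mh.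
  apply/ffunP => j; apply/val_inj/eqP/negPn/negP => gh.
  apply: (He _ _ (ltn_ord (g j)) (ltn_ord (h j)) gh) => i.
  apply: (HV _ _ _ (fun j => compn f (a i) (e (g j))) (fun j => compn f (a i) (e (h j)))
    (ltn_ord (c i)) (Mg i) (Mh i)) => phi cphi.
    by rewrite (expect_compn_hat cX)// HM// => x;
      apply: continuous_comp; [exact: continuous_compn|exact: cphi].
  by rewrite (expect_compn_hat cX)// HM// => x;
    apply: continuous_comp; [exact: continuous_compn|exact: cphi].
apply: le_ereal_inf_tmp => _ [l Fl <-]; rewrite lee_fin.
have [->|k0] := posnP k; first by rewrite ln0// mulr0 ln_nat_ge0.
have <- : ln ((k ^ m)%:R : R) = m%:R * ln k%:R.
  by rewrite natrX lnXn ?ltr0n// mulr_natl.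
by rewrite ler_ln_nat// kl.
Qed.

Lemma seq_entropy_hat_pinfty a : (0 < @seq_entropy R X (@open X) f a)%E ->
  @seq_entropy R _ (@weak_open R X x0) fhat a = +oo%E.
Proof.
move=> /ereal_sup_gt[_ [U oU <-] h0].
have [c c0 hc] : exists2 c : R, 0 < c & (c%:E < limn_esup
    (fun n => ((n%:R : R)^-1)%:E * logN (join_cover f a n U)))%E.
  move: h0; case: (limn_esup _) => [r|_|//]; last by exists 1; rewrite ?ltry.
  rewrite lte_fin => r0; exists (r / 2); first by rewrite divr_gt0.
  by rewrite lte_fin; lra.
apply/eqyP => A _.
pose m := (Num.truncn (`|A| / c)).+1.
have mA : A <= m%:R * c.
  by rewrite (le_trans (ler_norm A))// -ler_pdivrMr// ltW// truncnS_gt.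
apply: (@le_trans _ _ (m%:R * c)%:E); first by rewrite lee_fin.
have [V [oV HV]] := logN_join_power (ltn0Sn _ : (0 < m)%N) oU.
apply: le_trans (ereal_sup_ubound _); last by exists V.
(* Were the upper limit for [V] below [m * c], division by [m] would bound the one for [U] by
   [c]. *)
rewrite leNgt; apply/negP => /limn_esup_lt v_lt.
move: hc; rewrite ltNge => /negP; apply; apply: limn_esup_le.
apply: filterS v_lt => n; have [k [-> kV]] := HV a n.
move=> /(le_lt_trans (lee_wpmul2l _ kV)) => /(_ _)/=.
rewrite lee_fin invr_ge0 ler0n => /(_ isT).
by rewrite -!EFinM lte_fin lee_fin mulrCA ltr_pM2l// => /ltW.
Qed.

End EntropyLower.

(** * Coding measures by empirical averages *)

(* Exponential Markov bound: the weight theta ^ #|support c| sums to a product. *)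
Lemma sparse_card {R : realType} (I J : finType) (b : nat) (theta : R) :
  0 < theta <= 1 ->
  #|{: {c : {ffun I -> option J} | (#|[pred i | c i != None]| <= b)%N}}|%:R * theta ^+ b
    <= (1 + #|J|%:R * theta) ^+ #|I|.
Proof.
move=> /andP[t0 t1]; rewrite card_sig.
pose w (o : option J) : R := if o is Some _ then theta else 1.
have wE : \sum_(o : option J) w o = 1 + #|J|%:R * theta.
  rewrite (bigD1 None)//=; congr (_ + _).
  rewrite (eq_bigr (fun=> theta)); last by case.
  rewrite sumr_const -[LHS]mulr_natl.
  congr (_%:R * _).
  by rewrite (eq_card (B := predC1 None))// cardC1 card_option.
(* The power on the right expands into the total weight of all vectors; each sparse vector weighs at
   least [theta ^+ b]. *)
rewrite -wE -prodr_const bigA_distr_bigA/=.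
apply: (@le_trans _ _ (\sum_(c : {ffun I -> option J} | (#|[pred i | c i != None]| <= b)%N)
   \prod_i w (c i))).
  rewrite mulr_natl -sumr_const; apply: ler_sum => c cb.
  rewrite (bigID [pred i | c i != None])/= [X in _ * X]big1 ?mulr1; last first.
    by move=> i; rewrite negbK => /eqP ->.
  rewrite (eq_bigr (fun=> theta)) => [|i]; last by case: (c i).
  by rewrite prodr_const; apply: ler_wiXn2l => //; exact: ltW.
rewrite [leRHS](bigID (fun c : {ffun I -> option J} => (#|[pred i | c i != None]| <= b)%N))/=.
rewrite lerDl; apply: sumr_ge0 => c _; apply: prodr_ge0 => i _.
by rewrite /w; case: (c i) => // *; exact: ltW.
Qed.

Section Empirical.
Context {R : realType} {X : metricType R} {x0 : X}.
Hypothesis cX : compact [set: X].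
Implicit Types (mu nu : Meas X x0 R).

(* Each new sample point is chosen where the linear functional x |-> <S, psi(x)>,
   S being the accumulated error, does not exceed its mean; the squared Euclidean
   error then grows at most linearly. *)
Lemma empirical_points mu (I : finType) (psi : I -> X -> R) N :
  (forall i, continuous (psi i)) -> (forall i x, 0 <= psi i x <= 1) ->
  exists x : nat -> X,
    \sum_i (\sum_(t < N) psi i (x t) - N%:R * expect mu (psi i)) ^+ 2 <= N%:R * #|I|%:R.
Proof.
move=> cpsi bpsi; elim: N => [|N [x Hx]].
  exists (fun=> x0); rewrite mul0r big1// => i _.
  by rewrite big_ord0 mul0r subrr expr0n.
pose S i := \sum_(t < N) psi i (x t) - N%:R * expect mu (psi i).
pose g y := \sum_i S i * psi i y.
have cg : continuous g.
  apply: (continuous_big (op := +%R)) => [|i _]; first exact: add_continuous.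
  by apply: mulr_continuous_real; exact: cpsi.
(* The new point minimizes [g], and a minimum is at most the mean. *)
have [y _ Hy] : exists2 y, y \in [set: X] & forall z, z \in [set: X] -> g y <= g z.
  apply: (@compact_EVT_min X R g setT) => //; first by exists x0.
  exact: continuous_subspaceT.
have gE : expect mu g = \sum_i S i * expect mu (psi i).
  rewrite /g (expect_sum cX)/=; last by move=> i; exact: mulr_continuous_real.
  by apply: eq_bigr => i _; rewrite (expectZ cX).
have gy : g y <= expect mu g.
  rewrite -[leLHS](expect_cst mu); apply: (le_expect cX) => //.
    by move=> z; exact: cvg_cst.
  by move=> z; apply: Hy; rewrite inE.
exists (fun t => if (t == N)%N then y else x t).
have E i : \sum_(t < N.+1) psi i (if (t == N :> nat)%N then y else x t)
    - N.+1%:R * expect mu (psi i) = S i + (psi i y - expect mu (psi i)).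
  rewrite big_ord_recr/= eqxx (eq_bigr (fun t : 'I_N => psi i (x t))).
    by rewrite /S -natr1; ring.
  by move=> t _; rewrite ltn_eqF.
under eq_bigr do rewrite E.
(* Expanding the squares, the last term is at most 1 since [psi i y] and its mean lie in [[0, 1]];
   the cross terms add up to twice [g y - expect mu g], which is not positive. *)
apply: (@le_trans _ _ (\sum_i (S i ^+ 2 + 2 * (S i * psi i y - S i * expect mu (psi i)) + 1))).
  apply: ler_sum => i _; have /andP[h1 h2] := bpsi i y.
  have /andP[h3 h4] := expect01 cX mu (cpsi i) (bpsi i).
  by nra.
rewrite !big_split/= -mulr_sumr sumrB sumr_const -/(g y) -gE -natr1 mulrDl mul1r.
by move: Hx; rewrite -/S; lra.
Qed.

(** The code consists of the cover indices of a sample and, at coordinates where the sample errs by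
    at least [e / 8], the quantized integral. Equal codes mean, at each coordinate, either a common
    average within [e / 2] of both integrals or a common cell of width [1 / Q], at most [e]. *)
Lemma empirical_code (I : finType) (psi : I -> X -> R) k (W : 'I_k -> set X)
    (e : R) N Q b :
  (forall i, continuous (psi i)) -> (forall i x, 0 <= psi i x <= 1) ->
  (forall x, exists l, W l x) ->
  (forall l x y, W l x -> W l y -> forall i, `|psi i x - psi i y| <= e / 8) ->
  0 < e -> (0 < N)%N -> 1 <= Q%:R * e ->
  (forall c : nat, c%:R * (N%:R * (e / 8) ^+ 2) <= #|I|%:R -> (c <= b)%N) ->
  exists code : Meas X x0 R -> {ffun 'I_N -> 'I_k} *
      {c : {ffun I -> option 'I_Q.+1} | (#|[pred i | c i != None]| <= b)%N},
    forall mu nu, code mu = code nu ->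
    forall i, `|expect mu (psi i) - expect nu (psi i)| < e.
Proof.
move=> cpsi bpsi cW oscW e0 N0 Qe Hb.
have Nr : 0 < N%:R :> R by rewrite ltr0n.
have Q0 : 0 < Q%:R :> R.
  by rewrite -(pmulr_lgt0 _ e0); exact: lt_le_trans Qe.
(* A representative of each [W l], with [x0] as filler when [W l] is empty. *)
have /choice[p Hp] : forall l, exists y, forall x, W l x -> W l y.
  move=> l; have [[y Wy]|nW] := pselect (exists y, W l y); first by exists y.
  by exists x0 => x Wx; exfalso; apply: nW; exists x.
pose avg (g : {ffun 'I_N -> 'I_k}) i := (\sum_(t < N) psi i (p (g t))) / N%:R.
(* The value [t = 1] falls into cell [Q], hence [Q + 1] cells. *)
pose cell (t : R) : 'I_Q.+1 := inord (Num.truncn (Q%:R * t)).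
have code_ex mu : exists c : {ffun 'I_N -> 'I_k} *
      {c : {ffun I -> option 'I_Q.+1} | (#|[pred i | c i != None]| <= b)%N},
    forall i, match val c.2 i with
      | None => `|avg c.1 i - expect mu (psi i)| < e / 2
      | Some q => q = cell (expect mu (psi i))
    end.
  have [x Hx] := @empirical_points mu I psi N cpsi bpsi.
  have /choice[h Hh] : forall t : 'I_N, exists l, W l (x t) by move=> t; exact: cW.
  pose g : {ffun 'I_N -> 'I_k} := finfun h.
  pose D i := \sum_(t < N) psi i (x t) - N%:R * expect mu (psi i).
  pose c : {ffun I -> option 'I_Q.+1} :=
    [ffun i => if `|D i| < N%:R * (e / 8) then None else Some (cell (expect mu (psi i)))].
  have cb : (#|[pred i | c i != None]| <= b)%N.
    (* Chebyshev's inequality: each exceptional coordinate contributes at least the square of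
       [N * (e / 8)] to a total error of at most [N * #|I|]. *)
    apply: Hb; rewrite -(ler_pM2l Nr); apply: le_trans Hx.
    rewrite [leRHS](bigID [pred i | c i != None])/=.
    apply: (@le_trans _ _ (\sum_(i | c i != None) (N%:R * (e / 8)) ^+ 2)).
      rewrite sumr_const -[leRHS]mulr_natl.
      rewrite le_eqVlt; apply/orP; left; apply/eqP; ring.
    apply: (@le_trans _ _ (\sum_(i | c i != None) D i ^+ 2)).
      apply: ler_sum => i; rewrite /c ffunE; case: ltP => // h1 _.
      rewrite -[D i ^+ 2]real_normK ?num_real// lerXn2r ?nnegrE// mulr_ge0//.
      by rewrite divr_ge0// ltW.
    by rewrite lerDl; apply: sumr_ge0 => i _; exact: sqr_ge0.
  exists (g, exist _ c cb) => i /=.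
  rewrite /c ffunE; case: ltP => //= Di.
  (* Replacing sample points by representatives costs [e / 8] on average, as much again as the
     sampling error. *)
  have dist : `|\sum_(t < N) psi i (p (g t)) - \sum_(t < N) psi i (x t)| <= N%:R * (e / 8).
    rewrite -sumrB; apply: le_trans (ler_norm_sum _ _ _) _.
    rewrite mulr_natl -[X in _ *+ X]card_ord -sumr_const; apply: ler_sum => t _.
    rewrite /g ffunE; apply: (oscW (h t)); last exact: Hh.
    exact: Hp (Hh t).
  rewrite -(ltr_pM2l Nr) -[X in X * `|_|]gtr0_norm// -normrM mulrBr /avg.
  rewrite mulrCA divff ?gt_eqF// mulr1.
  rewrite -[X in `|X - _|](subrK (\sum_(t < N) psi i (x t))) -addrA.
  apply: le_lt_trans (ler_normD _ _) _.
  apply: lt_le_trans (ler_ltD dist Di) _.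
  rewrite -mulrDr ler_pM2l//; lra.
have /choice[code Hcode] := code_ex.
exists code => mu nu mn i; have := Hcode mu i; have := Hcode nu i; rewrite mn.
case: (val (code nu).2 i) => [q -> cellE|h1 h2].
  have E01 (m : Meas X x0 R) := expect01 cX m (cpsi i) (bpsi i).
  have cellK t : 0 <= t <= 1 -> (cell t)%:R <= Q%:R * t < (cell t)%:R + 1.
    move=> /andP[t0 t1]; have Qt : 0 <= Q%:R * t by rewrite mulr_ge0.
    rewrite /cell inordK; first by rewrite natr1; exact: truncn_itv.
    rewrite ltnS -(ler_nat R); apply: le_trans (_ : Q%:R * t <= _).
      by rewrite truncn_le.
    by rewrite ler_piMr.
  have := cellK _ (E01 mu); have := cellK _ (E01 nu); rewrite cellE.
  move=> /andP[l1 u1] /andP[l2 u2].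
  rewrite -(ltr_pM2l Q0) -[X in X * `|_|]gtr0_norm// -normrM mulrBr.
  apply: lt_le_trans Qe; rewrite ltr_norml.
  by move: l1 u1 l2 u2; clear; move=> *; apply/andP; split; lra.
apply: le_lt_trans (ler_distD (avg (code nu).1 i) _ _) _.
rewrite [e]splitr; apply: ltrD => //.
by rewrite distrC.
Qed.

Lemma small_oscillation_cover (phi : nat -> X -> R) r (e : R) : 0 < e ->
  (forall i, continuous (phi i)) ->
  exists U, open_cover (@open X) U /\ forall i x y, (i < size U)%N ->
    nth set0 U i x -> nth set0 U i y ->
    forall j, (j < r)%N -> `|phi j x - phi j y| <= e.
Proof.
move=> e0 cphi; have e20 : 0 < e / 2 by rewrite divr_gt0.
pose O (n : nat) (z : X) := [set x | forall j, (j < n)%N -> `|phi j z - phi j x| < e / 2].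
have oO n z : open (O n z).
  elim: n => [|n IH].
    by rewrite (_ : O _ _ = setT); [exact: openT|apply/seteqP; split].
  rewrite (_ : O _ _ = O n z `&` [set x | `|phi n z - phi n x| < e / 2]).
    apply: openI => //.
    have cn : continuous (fun x => `|phi n z - phi n x|).
      by move=> x; apply: cvg_norm; apply: cvgB; [exact: cvg_cst|exact: cphi].
    by move/continuousP: cn => /(_ _ (@open_lt R (e / 2))).
  apply/seteqP; split=> x /=.
    by move=> H; split; [move=> j jn; apply: H; exact: ltnW|exact: H].
  by move=> [H1 H2] j; rewrite ltnS leq_eqVlt => /predU1P[->|/H1].
have [|t Ht] := @finite_net R X x0 cX (O r).
  by move=> x; apply: open_nbhs_nbhs; split=> // j _; rewrite subrr normr0.
exists (map (O r) t); split; first split.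
- by move=> i; rewrite size_map => it; rewrite (nth_map x0).
- by move=> x; have [i it Oi] := Ht x; exists i; rewrite ?size_map// (nth_map x0).
- move=> i x y; rewrite size_map => it; rewrite (nth_map x0)// => Ox Oy j jr.
  apply: le_trans (ler_distD (phi j (nth x0 t i)) _ _) _.
  rewrite [e]splitr; apply: lerD; last exact: ltW (Oy j jr).
  by rewrite distrC; exact: ltW (Ox j jr).
Qed.

End Empirical.

(** * The upper bound *)

Section EntropyUpper.
Context {R : realType} {X : metricType R} {x0 : X}.
Hypothesis cX : compact [set: X].
Variable f : nat -> X -> X.
Hypothesis hf : forall n, continuous (f n).
Let fhat n := @hatmap R X x0 (f n) (@hf n).
Implicit Types (mu nu : Meas X x0 R).

(** A common affine map brings all test functions into [[0, 1]] and scales the tolerance by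
    [(2 * M)^-1]; indices from [size s] on get the zero function. *)
Lemma weak_cover_lebesgue01 (V : seq (set (Meas X x0 R))) :
  open_cover (@weak_open R X x0) V ->
  exists (phi : nat -> X -> R) r (e : R), [/\ forall i, continuous (phi i),
    forall i x, 0 <= phi i x <= 1, 0 < e &
    forall mu, exists2 i, (i < size V)%N & forall nu,
      (forall j, (j < r)%N -> `|expect nu (phi j) - expect mu (phi j)| < e) ->
      nth set0 V i nu].
Proof.
move=> oV; have [s [e [cs e0 HV]]] := weak_cover_lebesgue cX oV.
have [M M0 HM] : exists2 M : R, 0 < M & forall j, (j < size s)%N ->
    forall x, `|nth (fun=> 0) s j x| <= M.
  have : forall n, (n <= size s)%N -> exists2 M : R, 0 < M & forall j, (j < n)%N ->
      forall x, `|nth (fun=> 0) s j x| <= M.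
    elim=> [|n IH] ns; first by exists 1.
    have [M M0 HM] := IH (ltnW ns).
    have [M' M'0 HM'] := continuous_bounded (x0 := x0) cX (@cs n ns).
    exists (M + M'); first exact: addr_gt0.
    move=> j; rewrite ltnS leq_eqVlt => /predU1P[-> x|jn x].
      by rewrite (le_trans (HM' x))// lerDr ltW.
    by rewrite (le_trans (HM j jn x))// lerDl ltW.
  exact.
pose phi j x : R := if (j < size s)%N then (2 * M)^-1 * (nth (fun=> 0) s j x + M) else 0.
have M2 : 0 < (2 * M)^-1 by rewrite invr_gt0 mulr_gt0.
have cphi0 j : (j < size s)%N -> continuous (fun x => nth (fun=> 0) s j x + M).
  by move=> js; apply: addr_continuous_real; [exact: cs|exact: cst_continuous_real].
have phiE j : (j < size s)%N ->
    phi j = fun x => (2 * M)^-1 * (nth (fun=> 0) s j x + M).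
  by move=> js; apply/funext => x; rewrite /phi js.
have cphi j : continuous (phi j).
  have [js|js] := ltnP j (size s).
    by rewrite phiE//; apply: mulr_continuous_real; exact: cphi0.
  rewrite (_ : phi j = fun=> 0); first exact: cst_continuous_real.
  by apply/funext => x; rewrite /phi ltnNge js.
exists phi, (size s), ((2 * M)^-1 * e); split => //.
- move=> i x; rewrite /phi; case: ifP => js; last by rewrite lexx ler01.
  have := HM i js x; rewrite ler_norml => /andP[h1 h2].
  rewrite mulr_ge0 ?(ltW M2)//=; last by lra.
  by rewrite mulrC ler_pdivrMr ?mulr_gt0//; lra.
- exact: mulr_gt0.
- move=> mu; have [i iV Hi] := HV mu; exists i => // nu H; apply: Hi => j js.
  have E (m : Meas X x0 R) : expect m (phi j) =
      (2 * M)^-1 * (expect m (nth (fun=> 0) s j) + M).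
    rewrite phiE// (expectZ cX m (2 * M)^-1 (cphi0 j js)).
    by rewrite (expectD cX m (@cs j js) (@cst_continuous_real R X M)) expect_cst.
  have := H j js; rewrite !E -mulrBr normrM gtr0_norm// ltr_pM2l//.
  by rewrite opprD addrACA subrr addr0.
Qed.

(** The coding is applied to the functions [phi j] composed with [compn f (a i)], which vary by at
    most [e / 8] on each member of the join. Measures with equal codes thus have orbits that stay
    together in members of [V]. *)
Lemma subcover_join_hat a n (phi : nat -> X -> R) r (e : R) U V k N Q b :
  (forall i, continuous (phi i)) -> (forall i x, 0 <= phi i x <= 1) -> 0 < e ->
  (forall mu, exists2 i, (i < size V)%N & forall nu,
    (forall j, (j < r)%N -> `|expect nu (phi j) - expect mu (phi j)| < e) ->
    nth set0 V i nu) ->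
  (forall i x y, (i < size U)%N -> nth set0 U i x -> nth set0 U i y ->
    forall j, (j < r)%N -> `|phi j x - phi j y| <= e / 8) ->
  subcover_card (join_cover f a n U) k ->
  (0 < N)%N -> 1 <= Q%:R * e ->
  (forall c : nat, c%:R * (N%:R * (e / 8) ^+ 2) <= (n * r)%:R -> (c <= b)%N) ->
  subcover_card (join_cover fhat a n V) (k ^ N *
    #|{: {c : {ffun 'I_n * 'I_r -> option 'I_Q.+1} | (#|[pred i | c i != None]| <= b)%N}}|).
Proof.
move=> cphi bphi e0 HV HU [s [sk [sF cs]]] N0 Qe Hb.
pose psi (ij : 'I_n * 'I_r) := phi ij.2 \o compn f (a ij.1).
pose W (l : 'I_k) := nth set0 s l.
have [||||||||code Hcode] := @empirical_code R X x0 cX ('I_n * 'I_r)%type psi k W e N Q b => //.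
- move=> ij x; apply: continuous_comp; [exact: continuous_compn|exact: cphi].
- by move=> ij x; exact: bphi.
- by move=> x; have [l lk sl] := cs x; exists (Ordinal lk).
- move=> l x y; rewrite /W; have [c ->] := sF l (ltn_ord l) => Wx Wy [i j].
  exact: (HU (c i)).
- by move=> c; rewrite card_prod !card_ord; exact: Hb.
rewrite -[(k ^ N)%N](_ : #|{: {ffun 'I_N -> 'I_k}}| = _)%N; last first.
  by rewrite card_ffun !card_ord.
(* The point mass at [x0] shows that the space of measures is not empty. *)
have [mu0 _] : exists mu : Meas X x0 R, forall phi : X -> R, continuous phi ->
    expect mu phi = \sum_(i < 1) 1 * phi x0.
  by apply: (@convex_dirac R X x0 cX 1 (fun=> 1) (fun=> x0)) => //; rewrite big_ord1.
rewrite -card_prod; apply: (subcover_card_code (code := code) mu0).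
move=> mu; have /choice[c Hc] : forall i : 'I_n, exists l : 'I_(size V), forall nu,
    (forall j, (j < r)%N ->
      `|expect nu (phi j) - expect (compn fhat (a i) mu) (phi j)| < e) ->
    nth set0 V l nu.
  by move=> i; have [l lV Hl] := HV (compn fhat (a i) mu); exists (Ordinal lV).
exists [set nu | forall i : 'I_n, nth set0 V (c i) (compn fhat (a i) nu)].
  by exists c.
move=> nu cnu i; apply: Hc => j jr.
rewrite !(expect_compn_hat cX)//.
exact: (Hcode nu mu cnu (i, Ordinal jr)).
Qed.

(** The logarithm of the number of codes splits into [N * ln k] for the samples,
    [n * r * ln (1 + Q.+1 * theta)] for the weighted count of sparse vectors, and [b * lambda] for
    undoing the weights. The constants make each at most [n / 4]. *)
Lemma limn_esup_hat_le1 a (V : seq (set (Meas X x0 R))) :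
  (forall U, open_cover (@open X) U -> (limn_esup
    (fun n => ((n%:R : R)^-1)%:E * logN (join_cover f a n U)) <= 0)%E) ->
  open_cover (@weak_open R X x0) V ->
  (limn_esup (fun n => ((n%:R : R)^-1)%:E * logN (join_cover fhat a n V)) <= 1)%E.
Proof.
move=> h0 oV; have [phi [r [e [cphi bphi e0 HV]]]] := weak_cover_lebesgue01 oV.
have e80 : 0 < e / 8 by rewrite divr_gt0.
have [U [oU HU]] := @small_oscillation_cover R X x0 cX phi r (e / 8) e80 cphi.
pose Q := (Num.truncn e^-1).+1.
have Qe : 1 <= Q%:R * e by rewrite -ler_pdivrMr// mul1r ltW// truncnS_gt.
(* Chosen so that [r * Q.+1 * theta] is at most [1 / 4]. *)
pose theta : R := (1 + 4 * r%:R * Q.+1%:R)^-1.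
have d1 : 1 <= 1 + 4 * r%:R * Q.+1%:R :> R by rewrite lerDl !mulr_ge0.
have theta0 : 0 < theta by rewrite invr_gt0 (lt_le_trans ltr01).
have theta1 : theta <= 1 by rewrite invf_le1// (lt_le_trans ltr01).
pose lambda := - ln theta.
have lambda0 : 0 <= lambda by rewrite oppr_ge0 ln_le0.
(* The sample size does not depend on [n] and forces [b * lambda <= n / 4]; [r.+1] in place of [r]
   allows cancellation also when [r = 0]. *)
pose N := (Num.truncn (4 * r.+1%:R * lambda / (e / 8) ^+ 2)).+1.
have e820 : 0 < (e / 8) ^+ 2 by rewrite exprn_gt0.
have HN : 4 * r.+1%:R * lambda <= N%:R * (e / 8) ^+ 2.
  by rewrite -ler_pdivrMr// ltW// truncnS_gt.
have N0 : 0 < N%:R :> R by rewrite ltr0n.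
have : (limn_esup (fun n => ((n%:R : R)^-1)%:E * logN (join_cover f a n U))
    < ((4 * N%:R)^-1)%:E)%E.
  by apply: le_lt_trans (h0 U oU) _; rewrite lte_fin invr_gt0 mulr_gt0.
move=> /limn_esup_lt Ulim; apply: limn_esup_le.
near=> n.
have n0 : (0 < n)%N by near: n; exists 1%N.
have nr : 0 < n%:R :> R by rewrite ltr0n.
have : (((n%:R : R)^-1)%:E * logN (join_cover f a n U) < ((4 * N%:R)^-1)%:E)%E.
  by near: n.
have [k [Fk _ ->]] := @logN_attained R _ _ (subcover_card_join f a n x0 oU.2).
rewrite -EFinM lte_fin mulrC ltr_pdivrMr// => lnk.
pose b := Num.truncn ((n * r)%:R / (N%:R * (e / 8) ^+ 2)).
have Ne0 : 0 < N%:R * (e / 8) ^+ 2 by rewrite mulr_gt0.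
have bge0 : 0 <= (n * r)%:R / (N%:R * (e / 8) ^+ 2) by rewrite divr_ge0 ?(ltW Ne0).
have Hb (c : nat) : c%:R * (N%:R * (e / 8) ^+ 2) <= (n * r)%:R -> (c <= b)%N.
  by rewrite -ler_pdivlMr// => cb; rewrite truncn_ge_nat.
have bN : b%:R * (N%:R * (e / 8) ^+ 2) <= (n * r)%:R.
  by rewrite -ler_pdivlMr// truncn_le.
have [cnt Fhat Hcnt] : exists2 cnt : nat,
    subcover_card (join_cover fhat a n V) (k ^ N * cnt) &
    cnt%:R * theta ^+ b <= (1 + Q.+1%:R * theta) ^+ (n * r).
  eexists.
    exact: (subcover_join_hat cphi bphi e0 HV HU Fk (ltn0Sn _ : (0 < N)%N) Qe Hb).
  have := @sparse_card R ('I_n * 'I_r)%type 'I_Q.+1 b theta.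
  by rewrite theta0 theta1 card_prod !card_ord; apply.
apply: (@le_trans _ _ ((n%:R)^-1 * ln (k ^ N * cnt)%:R)%:E).
  by rewrite EFinM lee_wpmul2l ?lee_fin ?invr_ge0 ?logN_le.
rewrite lee_fin mulrC ler_pdivrMr// mul1r.
have [->|kc0] := posnP (k ^ N * cnt)%N; first by rewrite ln0.
move: kc0; rewrite muln_gt0 expn_gt0 orbF => /andP[k0 c0].
have k0R : 0 < k%:R :> R by rewrite ltr0n.
have c0R : 0 < cnt%:R :> R by rewrite ltr0n.
rewrite natrM natrX lnM ?posrE ?exprn_gt0// lnXn//.
have lnkN : ln (k%:R : R) *+ N <= n%:R / 4.
  rewrite -[ln _ *+ N]mulr_natr (_ : n%:R / 4 = (4 * N%:R)^-1 * n%:R * N%:R).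
    by rewrite ler_pM2r// ltW.
  by field; rewrite gt_eqF.
have lncnt : ln cnt%:R - b%:R * lambda <= n%:R / 4.
  have P1 : 0 < 1 + Q.+1%:R * theta by rewrite addr_gt0// mulr_gt0.
  have : ln (cnt%:R * theta ^+ b) <= ln ((1 + Q.+1%:R * theta) ^+ (n * r)).
    by rewrite ler_ln// posrE ?exprn_gt0// mulr_gt0// exprn_gt0.
  rewrite lnM ?posrE ?exprn_gt0// !lnXn// -[ln theta *+ b]mulr_natl.
  rewrite /lambda mulrN opprK => /le_trans; apply.
  rewrite -[ln _ *+ (n * r)]mulr_natl natrM.
  apply: (@le_trans _ _ (n%:R * r%:R * (Q.+1%:R * theta))).
    rewrite ler_wpM2l ?mulr_ge0// le_ln1Dx//.
    by rewrite (lt_trans (ltrN10 _))// mulr_gt0.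
  rewrite -mulrA ler_pM2l// mulrA /theta ler_pdivrMr ?(lt_le_trans ltr01)//.
  by rewrite [leRHS]mulrDr -[4 * _ * _]mulrA mulKf ?pnatr_eq0// lerDr mulr1 invr_ge0.
have blambda : b%:R * lambda <= n%:R / 4.
  have r1 : 0 < r.+1%:R :> R by rewrite ltr0n.
  have : b%:R * (4 * r.+1%:R * lambda) <= n%:R * r.+1%:R.
    apply: (@le_trans _ _ (b%:R * (N%:R * (e / 8) ^+ 2))); first by rewrite ler_wpM2l.
    by apply: le_trans bN _; rewrite -natrM ler_nat leq_mul2l leqnSn orbT.
  rewrite (_ : b%:R * _ = (4 * (b%:R * lambda)) * r.+1%:R); last by ring.
  by rewrite ler_pM2r// mulrC -ler_pdivlMr.
have lncnt2 : ln (cnt%:R : R) <= n%:R / 4 + n%:R / 4.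
  apply: (@le_trans _ _ (n%:R / 4 + b%:R * lambda)); last by rewrite lerD2l.
  by rewrite -lerBlDr.
apply: le_trans (lerD lnkN lncnt2) _.
rewrite [leRHS](_ : n%:R = n%:R / 4 + (n%:R / 4 + n%:R / 4) + n%:R / 4); last by field.
by rewrite lerDl divr_ge0.
Unshelve. all: by end_near. Qed.

Lemma seq_entropy_hat_le1 a : (@seq_entropy R X (@open X) f a <= 0)%E ->
  (@seq_entropy R _ (@weak_open R X x0) fhat a <= 1)%E.
Proof.
move=> h0; apply: ge_ereal_sup => _ [V oV <-]; apply: limn_esup_hat_le1 => // U oU.
by apply: le_trans h0; apply: ereal_sup_ubound; exists U.
Qed.

End EntropyUpper.

(** * The dichotomy for one sequence and for the supremum *)

Theorem theorem5p5 (R : realType) (X : metricType R) (x0 : X)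
    (hX : compact [set: X])
    (f : nat -> X -> X) (hf : forall n, continuous (f n)) :
  (forall a : nat -> nat, strict_incr a ->
     ((0 < @seq_entropy R X (@open X) f a)%E <->
      @seq_entropy R (Meas X x0 R) (@weak_open R X x0)
        (fun n => @hatmap R X x0 (f n) (hf n)) a = +oo%E)) /\
  ((0 < @hstar R X (@open X) f)%E <->
   @hstar R (Meas X x0 R) (@weak_open R X x0)
     (fun n => @hatmap R X x0 (f n) (hf n)) = +oo%E).
Proof.
have pinfty a := @seq_entropy_hat_pinfty R X x0 hX f hf a.
have le1 a := @seq_entropy_hat_le1 R X x0 hX f hf a.
split=> [a _|].
  split; first exact: pinfty.
  move=> hoo; rewrite ltNge; apply/negP => /le1.
  by rewrite hoo.
split=> [/ereal_sup_gt[_ [a ia <-] /pinfty ha]|hoo].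
  by apply/eqP; rewrite eq_le leey/= -ha; apply: ereal_sup_ubound; exists a.
rewrite ltNge; apply/negP => h0.
(* The bound 1 holds for all [a] alike, so it passes to the supremum. *)
suff : (@hstar R (Meas X x0 R) (@weak_open R X x0)
     (fun n => @hatmap R X x0 (f n) (hf n)) <= 1)%E by rewrite hoo.
apply: ge_ereal_sup => _ [a ia <-]; apply: le1; apply: le_trans h0.
by apply: ereal_sup_ubound; exists a.
Qed.
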